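(* There exist problem-independent (absolute) constants $C_1,C_2,C_3,C_M,C_\nu,C_s>0$ such that the following holds. Let $r\le d\le n$ be positive integers, with $n$ a power of $2$. Suppose that $\epsilon,\delta\in(0,C_3)$, $m,s$ are positive integers and $E>0$ satisfy $$1\le s\le C_sC_2^{-1}\epsilon^{-1}[4r+\log(1/\delta)],$$ $$C_M\le E\le C_2^2\epsilon^2 s\,[4r+\log(1/\delta)]^{-1}e^{C_s(C_2\epsilon s)^{-1}[4r+\log(1/\delta)]},$$ $$m\ge\max\left\{E\,C_2^{-2}\epsilon^{-2}[4r+\log(1/\delta)],\ s e\right\},$$ where $e$ is Euler's number. Let $\delta_1\in(0,1)$ and suppose further that $$n\ge\frac{\left(\sqrt{r}+\sqrt{8\log(n/\delta_1)}\right)^2}{s\,C_\nu^2C_1^{-2}\,\bar\mu(\epsilon,\delta)^2},$$ where $$\bar\mu(\epsilon,\delta):=C_1\sqrt{C_2}\sqrt{\epsilon}\,\min\left\{\frac{\log(E/(C_2\epsilon))}{4r+\log(1/\delta)},\ \sqrt{\frac{\log(E)}{4r+\log(1/\delta)}}\right\}.$$ Then for any matrix $A\in\mathbb{R}^{n\times d}$ with rank $r$, an HRHT matrix $S=S_hHD\in\mathbb{R}^{m\times n}$ (with $m\le n$) in which $S_h$ is an $s$-hashing matrix is an $\epsilon$-subspace embedding for $A$ with probability at least $(1-\delta)(1-\delta_1)$.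
   Context: $\epsilon$-subspace embedding (throughout, $\epsilon\in(0,1)$): $S\in\mathbb{R}^{m\times n}$ is an $\epsilon$-subspace embedding for $B\in\mathbb{R}^{n\times k}$ if $(1-\epsilon)\|y\|_2^2\le\|Sy\|_2^2\le(1+\epsilon)\|y\|_2^2$ for all $y\in\{Bz: z\in\mathbb{R}^k\}$. $s$-hashing matrix: a random matrix in $\mathbb{R}^{m\times n}$ such that, independently for each column $j\in\{1,\dots,n\}$, one samples without replacement $i_1,\dots,i_s\in\{1,\dots,m\}$ uniformly at random and sets the $(i_k,j)$ entry to $\pm1/\sqrt{s}$ (independent uniformly random signs) for $k=1,\dots,s$, all other entries of the column being $0$. Hashed-Randomised-Hadamard-Transform (HRHT): an $m\times n$ matrix of the form $S=S_hHD$ with $m\le n$, where $D$ is a random $n\times n$ diagonal matrix with independent (uniformly random) $\pm1$ diagonal entries; $H$ is the $n\times n$ Walsh--Hadamard matrix $H_{ij}=n^{-1/2}(-1)^{\langle(i-1)_2,(j-1)_2\rangle}$, where $(i-1)_2,(j-1)_2$ are the binary representation vectors of $i-1,j-1$ (e.g. $(3)_2=(1,1)$), padded to the same length; and $S_h$ is a random $m\times n$ $s$-hashing matrix (in this statement), independent of $D$. *)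

(* Defs.v *)
From mathcomp Require Import all_boot all_order all_algebra.
From mathcomp Require Import boolp reals sequences exp.

Set Implicit Arguments.
Unset Strict Implicit.
Unset Printing Implicit Defensive.

Import Order.TTheory GRing.Theory Num.Theory.

Local Open Scope ring_scope.

(* Probability of an event under the uniform law on a finite sample space.
   On a product of finite types this is the product of the uniform laws, i.e.
   the components of the sample are mutually independent and uniform. *)
Definition uniform_prob (R : realType) (T : finType) (E : T -> Prop) : R :=
  #|[set w : T | `[< E w >]]|%:R / #|T|%:R.

(* The norm provided by the library on matrices is the sup norm. *)
Definition norm2 (R : realType) (n : nat) (v : 'cV[R]_n) : R :=
  Num.sqrt (\sum_(i < n) v i 0 ^+ 2).

Definition subspace_embedding (R : realType) (m n k : nat) (eps : R)
    (S : 'M[R]_(m, n)) (B : 'M[R]_(n, k)) : Prop :=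
  forall y : 'cV[R]_n, (exists z : 'cV[R]_k, y = B *m z) ->
    (1 - eps) * norm2 y ^+ 2 <= norm2 (S *m y) ^+ 2
    /\ norm2 (S *m y) ^+ 2 <= (1 + eps) * norm2 y ^+ 2.

(* A uniform injective ffun 'I_s -> 'I_m is an ordered sample (i_1, ..., i_s)
   without replacement from the m rows. The type is empty when m < s. *)
Definition rows_sample (m s : nat) : finType :=
  {f : {ffun 'I_s -> 'I_m} | injectiveb f}.

(* One (rows, signs) pair for each of the n columns. *)
Definition hashing_sample (m n s : nat) : finType :=
  {ffun 'I_n -> rows_sample m s * {ffun 'I_s -> bool}}.

(* The rows val (w j).1 k are pairwise distinct, so for each (i, j) the sum
   below has at most one nonzero term. *)
Definition hashing_mx (R : realType) (m n s : nat) (w : hashing_sample m n s)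
    : 'M[R]_(m, n) :=
  \matrix_(i, j) \sum_(k < s | val (w j).1 k == i)
    (-1) ^+ ((w j).2 k) / Num.sqrt s%:R.

Definition sign_diag_mx (R : realType) (n : nat) (b : {ffun 'I_n -> bool})
    : 'M[R]_n :=
  diag_mx (\row_j (-1) ^+ (b j)).

Definition bit (i k : nat) : bool := odd (i %/ 2 ^ k)%N.

(* Indices in 'I_n start at 0, and binary expansions are padded to length
   up_log 2 n, which is log_2 n when n is a power of 2. *)
Definition walsh_hadamard (R : realType) (n : nat) : 'M[R]_n :=
  \matrix_(i, j)
    ((Num.sqrt n%:R)^-1 * (-1) ^+ (\sum_(k < up_log 2 n) bit i k * bit j k)%N).

Definition hrht_sample (m n s : nat) : finType :=
  (hashing_sample m n s * {ffun 'I_n -> bool})%type.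

Definition hrht_mx (R : realType) (m n s : nat) (w : hrht_sample m n s)
    : 'M[R]_(m, n) :=
  hashing_mx R w.1 *m walsh_hadamard R n *m sign_diag_mx R w.2.

Definition mu_bar (R : realType) (C1 C2 : R) (r : nat) (E eps delta : R) : R :=
  C1 * Num.sqrt C2 * Num.sqrt eps *
  Num.min (ln (E / (C2 * eps)) / (4 * r%:R + ln (1 / delta)))
          (Num.sqrt (ln E / (4 * r%:R + ln (1 / delta)))).

(* Main.v *)
(* With [U] an orthonormal basis of the column space of [A] and [V = H D U],
   a net argument and a Hoeffding bound show that with probability [1 - delta1]
   every row of [V] has norm at most a multiple of [sqrt s * mu_bar].  For such
   a [D], the distortion of a unit vector [x] in the range of [V] is the off
   diagonal quadratic form
     Y = 1/s sum_i sum_(j <> j') xi_ij xi_ij' x_j x_j',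
   whose entries [xi_ij] are the signs of the hashing matrix.  Sampling rows
   without replacement only decreases the moments of monomials in the [xi_ij]
   with respect to independent sparse signs, [P(xi_ij <> 0) = p = s/m], so the
   even moments of [Y] are at most those of a sum of [m] independent row forms.
   If [l] is the number of columns that meet a monomial of degree [2k] of one
   row form (each of them at least twice, and [l >= 2]), the [k]-th moment of a
   row is at most sum_(2 <= l <= k) p^l l^(2k) mu^(2(k-l)) / l!.  An exponential
   series truncated at the order [q ~ 4r + log(1/delta)] of the moment turns
   this into P(|Y| > eps/4) <= e^(-5q); the truncation matters, because the full
   exponential moment may be far too large.  This probability beats the size
   e^(18r) of a net of integer points in the ball of radius [4 sqrt r], which
   controls quadratic forms exactly, by rounding and polarization. *)
Require Import Defs.
From mathcomp Require Import all_boot all_order all_algebra perm.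
From mathcomp Require Import boolp reals sequences exp.
From mathcomp Require Import ring lra zify.
Import Order.TTheory GRing.Theory Num.Theory.
Local Open Scope ring_scope.

(** * Truncated exponential series *)

Lemma sum_expn_fact_le_expR (R : realType) (y : R) (N : nat) :
  0 <= y -> \sum_(w < N) y ^+ w / w`!%:R <= expR y.
Proof.
move=> y0; rewrite /expR.
have -> : \sum_(w < N) y ^+ w / w`!%:R = series (exp_coeff y) N.
  by rewrite /series /= big_mkord; apply: eq_bigr => i _; rewrite /exp_coeff /= mulrC.
apply: nondecreasing_cvgn_le; last exact: is_cvg_series_exp_coeff.
apply: nondecreasing_series => n _ _.
by rewrite /exp_coeff /= divr_ge0 // exprn_ge0.
Qed.

Lemma expn_div_fact_le_expR (R : realType) (y : R) (n : nat) :
  0 <= y -> y ^+ n / n`!%:R <= expR y.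
Proof.
move=> y0; apply: (le_trans _ (@sum_expn_fact_le_expR R y n.+1 y0)).
rewrite big_ord_recr /= lerDr; apply: sumr_ge0 => i _.
by rewrite divr_ge0 // exprn_ge0.
Qed.

(** For [w <= N] and [th <= 1], [th ^+ N * y ^+ w <= (th * y) ^+ w]. When [y] is far above [N], a
    small [th] makes this much better than the full exponential. *)
Lemma trunc_exp_le (R : realType) (y th : R) (N : nat) :
  0 <= y -> 0 < th <= 1 ->
  \sum_(w < N.+1) y ^+ w / w`!%:R <= th ^- N * expR (th * y).
Proof.
move=> y0 /andP[th0 th1].
rewrite ler_pdivlMl ?exprn_gt0 //.
apply: (le_trans _ (@sum_expn_fact_le_expR R (th * y) N.+1 (mulr_ge0 (ltW th0) y0))).
rewrite mulr_sumr; apply: ler_sum => i _.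
rewrite exprMn mulrA; apply: ler_wpM2r; first by rewrite invr_ge0.
apply: ler_wpM2r; first exact: exprn_ge0.
by apply: ler_wiXn2l; rewrite ?(ltW th0) // -ltnS.
Qed.

(** For [0 <= x <= 1/2] the bounds [expR x <= 1 / (1 - x)] and [expR (- x) <= 1 / (1 + x)] average
    to [1 / (1 - x ^+ 2) <= 1 + 2 * x ^+ 2]. For larger [x], [x <= 2 * x ^+ 2] suffices. *)
Lemma cosh_le_expR_sqr (R : realType) (x : R) :
  (expR x + expR (- x)) / 2 <= expR (2 * x ^+ 2).
Proof.
wlog x0 : x / 0 <= x => [hw|].
  case: (leP 0 x) => [/hw //|/ltW]; rewrite -oppr_ge0 => /hw.
  by rewrite opprK sqrrN addrC.
case: (leP x (1/2)) => hx; last first.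
  have h1 : expR x <= expR (2 * x ^+ 2) by rewrite ler_expR; nra.
  have h2 : expR (- x) <= expR x by rewrite ler_expR; lra.
  by lra.
have hy : 0 < 1 - x ^+ 2 by nra.
have ha : expR x <= (1 - x)^-1.
  rewrite -[expR x]invrK -expRN lef_pV2 ?posrE ?expR_gt0 //; last lra.
  by have := expR_ge1Dx (- x).
have hb : expR (- x) <= (1 + x)^-1.
  rewrite expRN lef_pV2 ?posrE ?expR_gt0 //; last lra.
  by have := expR_ge1Dx x.
apply: (@le_trans _ _ (1 - x ^+ 2)^-1).
  have -> : (1 - x ^+ 2)^-1 = ((1 - x)^-1 + (1 + x)^-1) / 2.
    have : 1 - x != 0 by lra.
    have : 1 + x != 0 by lra.
    have : 1 - x ^+ 2 != 0 by rewrite gt_eqF.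
    by move=> *; field; do ?[apply/andP; split].
  lra.
apply: (le_trans _ (expR_ge1Dx (2 * x ^+ 2))).
have h1 : 0 < 1 + 2 * x ^+ 2 by nra.
rewrite invf_ple ?posrE //.
rewrite -[leLHS]mul1r ler_pdivrMr //.
have : x ^+ 2 <= 1 / 4 by nra.
have : 0 <= x ^+ 2 by nra.
move: (x ^+ 2) => t; nra.
Qed.

(** Put [k = w + l] and use [(w + l)! >= w! * l!]. The part of each term that depends on [l] alone
    is then [(l ^ l / l!) ^ 2], which is at most [expR (2 * l)]. *)
Lemma inner_sum_le (R : realType) (b : R) (l q : nat) :
  0 <= b ->
  \sum_(l <= k < q.+1) b ^+ (k - l) * l%:R ^+ (2 * k) / (k`!%:R * l`!%:R)
  <= expR (2 * l%:R) * \sum_(w < q.+1) (b * l%:R ^+ 2) ^+ w / w`!%:R.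
Proof.
move=> b0; rewrite -{1}[l]add0n big_addn big_mkord mulr_sumr.
have y0 : 0 <= b * l%:R ^+ 2 by rewrite mulr_ge0 // exprn_ge0.
apply: (@le_trans _ _ (\sum_(w < q.+1 - l)
    expR (2 * l%:R) * ((b * l%:R ^+ 2) ^+ w / w`!%:R))); last first.
  rewrite (big_ord_widen q.+1 (fun w => expR (2 * l%:R) *
    ((b * l%:R ^+ 2) ^+ w / w`!%:R))) ?leq_subr //.
  rewrite big_mkcond /=; apply: ler_sum => i _; case: ifP => // _.
  by rewrite mulr_ge0 ?expR_ge0 // divr_ge0 // exprn_ge0.
apply: ler_sum => w _; rewrite addnK.
have f0 n : 0 < n`!%:R :> R by rewrite ltr0n fact_gt0.
have hl : l%:R ^+ l / l`!%:R <= expR l%:R :> R by exact: expn_div_fact_le_expR.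
apply: (@le_trans _ _ ((l%:R ^+ l / l`!%:R) ^+ 2 * ((b * l%:R ^+ 2) ^+ w / w`!%:R))).
  have -> : b ^+ w * l%:R ^+ (2 * (w + l)) / ((w + l)`!%:R * l`!%:R) =
     (l%:R ^+ l) ^+ 2 * (b * l%:R ^+ 2) ^+ w / ((w + l)`!%:R * l`!%:R).
    by rewrite exprMn -!exprM mulnDr exprD (mulnC l 2); ring.
  have -> : (l%:R ^+ l / l`!%:R) ^+ 2 * ((b * l%:R ^+ 2) ^+ w / w`!%:R) =
     (l%:R ^+ l) ^+ 2 * (b * l%:R ^+ 2) ^+ w / (l`!%:R * w`!%:R * l`!%:R).
    have := f0 l; have := f0 w => h1 h2.
    by field; rewrite !gt_eqF.
  rewrite ler_wpM2l //; first by rewrite mulr_ge0 // exprn_ge0 // exprn_ge0.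
  rewrite lef_pV2 ?posrE ?mulr_gt0 // ler_pM2r // -natrM ler_nat.
  have := bin_fact (leq_addl w l); rewrite addnK => <-.
  by apply: leq_pmull; rewrite bin_gt0 leq_addl.
apply: ler_wpM2r; first by rewrite divr_ge0 // exprn_ge0.
have -> : expR (2 * l%:R) = expR l%:R ^+ 2 :> R by rewrite -expRM_natl.
by rewrite lerXn2r // nnegrE ?expR_ge0 // divr_ge0 // exprn_ge0.
Qed.

(* Splitting at [8 q = Lam * l]: below it [b * l ^ 2 <= Lam * l / 8], above it
   the truncation of the series at order [q] is what keeps it small. *)
Lemma trunc_exp_quadratic_le (R : realType) (b Lam : R) (l q : nat) :
  (0 < q)%N -> 0 <= b -> 0 < Lam -> b <= 64^-1 * Lam ^+ 2 / q%:R ->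
  \sum_(w < q.+1) (b * l%:R ^+ 2) ^+ w / w`!%:R <= expR (Lam * l%:R / 4).
Proof.
move=> q0 b0 L0 hb.
have qR : 0 < q%:R :> R by rewrite ltr0n.
have y0 : 0 <= b * l%:R ^+ 2 by rewrite mulr_ge0 // exprn_ge0.
have l0 : 0 <= l%:R :> R by [].
have hy : b * l%:R ^+ 2 <= (Lam * l%:R) ^+ 2 / (64 * q%:R).
  have -> : (Lam * l%:R) ^+ 2 / (64 * q%:R) = (64^-1 * Lam ^+ 2 / q%:R) * l%:R ^+ 2.
    by field; rewrite gt_eqF.
  by apply: ler_wpM2r; rewrite ?exprn_ge0.
have u0 : 0 <= Lam * l%:R by rewrite mulr_ge0 // ltW.
set u := Lam * l%:R in hy u0 *.
case: (leP u (8 * q%:R)) => hu.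
  apply: le_trans (sum_expn_fact_le_expR R _ _ y0) _.
  rewrite ler_expR; apply: le_trans hy _.
  rewrite ler_pdivrMr; last lra.
  nra.
have u1 : 0 < u by lra.
(* [trunc_exp_le] is applied with [th = 8 * q / u]. Each of its two factors, [th ^- q] and
   [expR (th * y)], is then at most [expR (u / 8)]. *)
have hth : 0 < 8 * q%:R / u <= 1.
  by apply/andP; split; [rewrite divr_gt0 //; lra | rewrite ler_pdivrMr //; lra].
apply: le_trans (trunc_exp_le R _ _ q y0 hth) _.
have -> : u / 4 = u / 8 + u / 8 by field.
rewrite expRD; apply: ler_pM; rewrite ?expR_ge0 //.
- by rewrite invr_ge0 exprn_ge0 // ltW //; case/andP: hth.
- rewrite -exprVn invf_div.
  apply: (@le_trans _ _ (expR (u / (8 * q%:R)) ^+ q)).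
    rewrite lerXn2r ?nnegrE ?expR_ge0 ?divr_ge0 //; try lra.
    by apply: le_trans (expR_ge1Dx _); lra.
  rewrite -expRM_natl.
  have -> // : q%:R * (u / (8 * q%:R)) = u / 8 by field; rewrite gt_eqF.
rewrite ler_expR.
apply: (@le_trans _ _ (8 * q%:R / u * (u ^+ 2 / (64 * q%:R)))).
  by apply: ler_wpM2l => //; rewrite ltW //; case/andP: hth.
have -> // : 8 * q%:R / u * (u ^+ 2 / (64 * q%:R)) = u / 8.
by field; rewrite !gt_eqF.
Qed.

Lemma geom_half_le (R : realType) (q : nat) :
  \sum_(3 <= l < q) (1 / 2 : R) ^+ l.-1 <= 1 / 2.
Proof.
have H n : \sum_(3 <= l < 3 + n) (1 / 2 : R) ^+ l.-1 = 1 / 2 - (1 / 2) ^+ (n + 1).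
  elim: n => [|n IH]; first by rewrite addn0 big_geq // add0n expr1 subrr.
  rewrite addnS big_nat_recr ?leq_addr //= IH addnC !addnS !addn0 !addSn add0n /=.
  rewrite !exprS; lra.
case: (leqP 3 q) => hq; last by rewrite big_geq ?divr_ge0 // ltnW.
rewrite -(subnKC hq) H.
have : 0 <= (1 / 2 : R) ^+ (q - 3 + 1) by rewrite exprn_ge0 // divr_ge0.
lra.
Qed.

(** The term [l = 2] carries a single factor [A] and is kept apart. For [l >= 3] the factor
    [A ^+ l.-1] outweighs the growth [expR (2 * l + Lam * l / 4)]: the total exponent of [Lam] is
    [1 - 3 / 4 * l <= -1], and [(rho * expR 2) ^+ l.-1] leaves a geometric series. *)
Lemma double_sum_le (R : realType) (b A rho Lam : R) (q : nat) :
  (0 < q)%N -> 0 <= b -> 0 < Lam -> b <= 64^-1 * Lam ^+ 2 / q%:R ->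
  0 <= A -> A <= rho * expR (- Lam) -> 0 <= rho -> rho * expR 2 <= 1 / 2 ->
  \sum_(2 <= l < q.+1) \sum_(l <= k < q.+1)
     b ^+ (k - l) * A ^+ l.-1 * l%:R ^+ (2 * k) / (k`!%:R * l`!%:R)
  <= A * expR 4 * expR (4 * b) + expR 2 / 2 * expR (- Lam).
Proof.
move=> q0 b0 L0 hb A0 hA rho0 hrho.
have hin l : \sum_(l <= k < q.+1)
     b ^+ (k - l) * A ^+ l.-1 * l%:R ^+ (2 * k) / (k`!%:R * l`!%:R) =
   A ^+ l.-1 * \sum_(l <= k < q.+1)
     b ^+ (k - l) * l%:R ^+ (2 * k) / (k`!%:R * l`!%:R).
  rewrite mulr_sumr; apply: eq_bigr => k _.
  by rewrite -!mulrA mulrCA !mulrA.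
case: (ltnP 1 q) => q2; last first.
  rewrite big_geq //; apply: addr_ge0; rewrite !mulr_ge0 ?expR_ge0 ?invr_ge0 //.
rewrite big_ltn //.
apply: lerD.
  rewrite hin /= expr1 -mulrA; apply: ler_wpM2l => //.
  apply: le_trans (inner_sum_le R _ _ _ b0) _.
  have -> : 2 * 2%:R = 4 :> R by lra.
  apply: ler_wpM2l; first exact: expR_ge0.
  have y0 : 0 <= b * 2%:R ^+ 2 by rewrite mulr_ge0 // exprn_ge0.
  apply: le_trans (sum_expn_fact_le_expR R _ _ y0) _.
  by rewrite ler_expR; lra.
apply: (@le_trans _ _ (\sum_(3 <= l < q.+1) expR 2 * expR (- Lam) * (1 / 2) ^+ l.-1)).
  apply: ler_sum_nat => l /andP[l3 lq].
  rewrite hin.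
  apply: le_trans (ler_wpM2l (exprn_ge0 _ A0) (inner_sum_le R _ _ _ b0)) _.
  apply: (@le_trans _ _ ((rho * expR (- Lam)) ^+ l.-1 *
     (expR (2 * l%:R) * expR (Lam * l%:R / 4)))).
    apply: ler_pM; rewrite ?exprn_ge0 //.
    - rewrite mulr_ge0 ?expR_ge0 // sumr_ge0 // => i _.
      by rewrite divr_ge0 // exprn_ge0 // mulr_ge0 // exprn_ge0.
    - by rewrite lerXn2r // nnegrE // mulr_ge0 // expR_ge0.
    - apply: ler_wpM2l; first exact: expR_ge0.
      exact: trunc_exp_quadratic_le.
  have -> : (rho * expR (- Lam)) ^+ l.-1 * (expR (2 * l%:R) * expR (Lam * l%:R / 4)) =
     (rho * expR 2) ^+ l.-1 * (expR 2 * expR (Lam * (1 - 3 / 4 * l%:R))).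
    case: l l3 {lq} => // l _ /=.
    rewrite !exprMn -!expRM_natl.
    have -> : 2 * l.+1%:R = l%:R * 2 + 2 :> R by rewrite -natr1; lra.
    have -> : Lam * (1 - 3 / 4 * l.+1%:R) = l%:R * - Lam + Lam * l.+1%:R / 4 :> R.
      by rewrite -natr1; lra.
    by rewrite !expRD; ring.
  rewrite mulrC; apply: ler_pM; rewrite ?mulr_ge0 ?expR_ge0 ?exprn_ge0 ?mulr_ge0 ?expR_ge0 //.
    apply: ler_wpM2l; first exact: expR_ge0.
    rewrite ler_expR.
    have : 3 <= l%:R :> R by rewrite (ler_nat _ 3 l).
    nra.
  by rewrite lerXn2r // nnegrE ?mulr_ge0 ?expR_ge0 //; lra.
rewrite -mulr_sumr.
apply: le_trans (ler_wpM2l _ (geom_half_le R q.+1)) _.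
  by rewrite mulr_ge0 ?expR_ge0.
by have := expR_ge0 (2:R); nra.
Qed.

(** * Moments of polynomials in random variables *)

Lemma prodr_ord (R : comNzRingType) (q : nat) (x : R) : \prod_(i < q) x = x ^+ q.
Proof. by rewrite prodr_const card_ord. Qed.

Lemma moment_expand (R : realType) (W I T : finType) (P : W -> R)
    (xi : W -> I -> R) (u : T -> R) (a : T -> I -> nat) (q : nat) :
  \sum_w P w * (\sum_t u t * \prod_i xi w i ^+ a t i) ^+ q =
  \sum_(g : {ffun 'I_q -> T}) (\prod_k u (g k)) *
     \sum_w P w * \prod_i xi w i ^+ (\sum_k a (g k) i)%N.
Proof.
have E w : (\sum_t u t * \prod_i xi w i ^+ a t i) ^+ q =
   \sum_(g : {ffun 'I_q -> T}) (\prod_k u (g k)) *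
      \prod_i xi w i ^+ (\sum_k a (g k) i)%N.
  rewrite -[LHS]prodr_ord bigA_distr_bigA /=.
  apply: eq_bigr => g _; rewrite big_split /=; congr (_ * _).
  rewrite exchange_big /=; apply: eq_bigr => i _.
  by rewrite -expr_sum.
under eq_bigr => w _ do rewrite E mulr_sumr.
rewrite exchange_big /=; apply: eq_bigr => g _.
by rewrite mulr_sumr; apply: eq_bigr => w _; rewrite mulrCA.
Qed.

(* Since all moments of the [xi1] are nonnegative, dropping the signs of the
   coefficients [u] can only increase the left-hand side. *)
Lemma moment_domination (R : realType) (W1 W2 I T : finType) (P1 : W1 -> R)
    (P2 : W2 -> R) (xi1 : W1 -> I -> R) (xi2 : W2 -> I -> R)
    (u : T -> R) (a : T -> I -> nat) (q : nat) :
  (forall al : I -> nat,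
     0 <= \sum_w P1 w * \prod_i xi1 w i ^+ al i
       <= \sum_w P2 w * \prod_i xi2 w i ^+ al i) ->
  \sum_w P1 w * (\sum_t u t * \prod_i xi1 w i ^+ a t i) ^+ q <=
  \sum_w P2 w * (\sum_t `|u t| * \prod_i xi2 w i ^+ a t i) ^+ q.
Proof.
move=> H; rewrite !moment_expand; apply: ler_sum => g _.
have /andP[h0 h1] := H (fun i => \sum_k a (g k) i)%N.
apply: le_trans (ler_norm _) _; rewrite normrM (ger0_norm h0) normr_prod.
by apply: ler_wpM2l => //; apply: prodr_ge0 => k _.
Qed.

(** * Generating polynomials of moments *)

Definition trunc_exp_poly {R : realType} (q : nat) (z : R) : {poly R} :=
  \poly_(a < q.+1) (z ^+ a / a`!%:R).

Lemma coef_trunc_exp_poly (R : realType) q (z : R) a :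
  (a <= q)%N -> (trunc_exp_poly q z)`_a = z ^+ a / a`!%:R.
Proof. by move=> aq; rewrite coef_poly ltnS aq. Qed.

(** Truncation at degree [q] does not affect coefficients up to [q], so there the polynomials
    multiply like exponentials, by the binomial theorem. *)
Lemma coef_prod_trunc_exp_poly (R : realType) (I : Type) (r : seq I) (z : I -> R) q k :
  (k <= q)%N ->
  (\prod_(i <- r) trunc_exp_poly q (z i))`_k = (\sum_(i <- r) z i) ^+ k / k`!%:R.
Proof.
elim: r k => [|i r IH] k kq.
  rewrite !big_nil coef1 expr0n; case: k kq => [|k] _ /=; rewrite ?mul0r //.
  by rewrite fact0 divr1.
rewrite !big_cons coefM exprDn mulr_suml; symmetry.
rewrite (reindex_inj rev_ord_inj) /=; apply: eq_bigr => j _.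
rewrite subSS (subKn (leq_ord j)) IH ?(leq_trans (leq_subr _ _)) //.
rewrite coef_trunc_exp_poly; last by rewrite (leq_trans _ kq) // leq_ord.
have jk : (j <= k)%N by exact: leq_ord.
have := bin_fact (leq_subr j k); rewrite (subKn jk) => /(congr1 (fun n : nat => n%:R : R)).
have f0 n : n`!%:R != 0 :> R by rewrite pnatr_eq0 -lt0n fact_gt0.
rewrite !natrM => hb; rewrite -mulr_natr.
have -> : 'C(k, k - j)%:R = k`!%:R / (j`!%:R * (k - j)`!%:R) :> R.
  by rewrite -hb; field; rewrite !f0.
by field; rewrite !f0.
Qed.

Lemma coef_le_horner (R : realType) (P : {poly R}) (lam : R) (q : nat) :
  0 <= lam -> (forall i, 0 <= P`_i) -> P`_q * lam ^+ q <= P.[lam].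
Proof.
move=> l0 P0; case: (ltnP q (size P)) => qs; last first.
  rewrite nth_default // mul0r horner_coef sumr_ge0 // => i _.
  by rewrite mulr_ge0 ?exprn_ge0.
rewrite horner_coef (bigD1 (Ordinal qs)) //= lerDl sumr_ge0 // => i _.
by rewrite mulr_ge0 ?exprn_ge0.
Qed.

Lemma coef_prod_ge0 (R : realType) (I : Type) (r : seq I) (P : I -> {poly R}) k :
  (forall i j, 0 <= (P i)`_j) -> 0 <= (\prod_(i <- r) P i)`_k.
Proof.
move=> H; elim: r k => [|i r IH] k; first by rewrite big_nil coef1 ler0n.
by rewrite big_cons coefM sumr_ge0 // => j _; rewrite mulr_ge0.
Qed.

(** The moment is [q!] times the coefficient of degree [q] in [Pb ^+ m], where [Pb] averages the
    truncated exponentials of one summand. The coefficients of [Pb] are nonnegative, so that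
    coefficient is bounded by evaluation at [lam]. Only moments of order at most [q] enter. *)
Lemma moment_iid_sum_le (R : realType) (T : finType) (m q : nat) (P : T -> R)
    (Q : T -> R) (lam : R) :
  0 < lam ->
  (forall k, 0 <= \sum_t P t * Q t ^+ k) ->
  \sum_(z : {ffun 'I_m -> T}) (\prod_i P (z i)) * (\sum_i Q (z i)) ^+ q
  <= q`!%:R / lam ^+ q *
     (\sum_(k < q.+1) lam ^+ k * (\sum_t P t * Q t ^+ k) / k`!%:R) ^+ m.
Proof.
move=> l0 H.
pose Pb : {poly R} := \sum_t P t *: trunc_exp_poly q (Q t).
have PbE k : (k <= q)%N -> Pb`_k = (\sum_t P t * Q t ^+ k) / k`!%:R.
  move=> kq; rewrite coef_sum mulr_suml; apply: eq_bigr => t _.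
  by rewrite coefZ coef_trunc_exp_poly // mulrA.
have Pb0 k : 0 <= Pb`_k.
  case: (leqP k q) => kq; first by rewrite PbE // divr_ge0.
  rewrite coef_sum big1 // => t _; rewrite coefZ coef_poly ltnS leqNgt kq /=.
  by rewrite mulr0.
have hz : Pb.[lam] = \sum_(k < q.+1) lam ^+ k * (\sum_t P t * Q t ^+ k) / k`!%:R.
  have sz : (size Pb <= q.+1)%N.
    apply/leq_sizeP => j qj; rewrite coef_sum big1 // => t _.
    by rewrite coefZ coef_poly ltnNge qj /= mulr0.
  rewrite (horner_coef_wide _ sz); apply: eq_bigr => k _.
  rewrite PbE; last exact: leq_ord.
  by rewrite mulrC mulrA.
have f0 : 0 < q`!%:R :> R by rewrite ltr0n fact_gt0.
have -> : \sum_(z : {ffun 'I_m -> T}) (\prod_i P (z i)) * (\sum_i Q (z i)) ^+ q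
   = q`!%:R * (Pb ^+ m)`_q.
  have -> : Pb ^+ m = \sum_(z : {ffun 'I_m -> T})
      (\prod_i P (z i)) *: \prod_i trunc_exp_poly q (Q (z i)).
    rewrite -[LHS]prodr_ord bigA_distr_bigA /=.
    by apply: eq_bigr => z _; rewrite scaler_prod.
  rewrite coef_sum mulr_sumr; apply: eq_bigr => z _.
  rewrite coefZ (coef_prod_trunc_exp_poly _ _ _ (fun i => Q (z i))) //.
  by field; rewrite gt_eqF.
rewrite -mulrA; apply: ler_wpM2l; first exact: ltW.
rewrite ler_pdivlMl ?exprn_gt0 // mulrC -hz -horner_exp.
apply: coef_le_horner; first exact: ltW.
move=> k; rewrite -[Pb ^+ m]prodr_ord.
exact: coef_prod_ge0.
Qed.

Lemma prod_expn_eq (R : comNzRingType) (I : finType) (F : I -> R) (i : I) :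
  \prod_j F j ^+ (j == i) = F i.
Proof.
rewrite (bigD1 i) //= eqxx expr1 big1 ?mulr1 // => j /negbTE ->.
by rewrite expr0.
Qed.

(** The exponent vector of the monomial in the two variables named by [t], the form in which
    [moment_expand] takes a quadratic form. *)
Definition pair_exponent {n : nat} (t : 'I_n * 'I_n) (j : 'I_n) : nat :=
  ((j == t.1) + (j == t.2))%N.

Lemma prod_pair_exponent (R : comNzRingType) n (F : 'I_n -> R) t :
  \prod_j F j ^+ pair_exponent t j = F t.1 * F t.2.
Proof.
under eq_bigr => j _ do rewrite exprD.
by rewrite big_split /= !prod_expn_eq.
Qed.

Lemma sum_pair_exponent n (t : 'I_n * 'I_n) : (\sum_j pair_exponent t j = 2)%N.
Proof.
have H i : (\sum_(j : 'I_n) (j == i) = 1)%N.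
  by rewrite (bigD1 i) //= eqxx big1 // => j /negbTE ->.
by rewrite big_split /= !H.
Qed.

Lemma coef_prod_le (R : realType) (I : Type) (r : seq I) (P Q : I -> {poly R}) k :
  (forall i j, 0 <= (P i)`_j <= (Q i)`_j) ->
  (\prod_(i <- r) P i)`_k <= (\prod_(i <- r) Q i)`_k.
Proof.
move=> H; elim: r k => [|i r IH] k; first by rewrite !big_nil.
rewrite !big_cons !coefM; apply: ler_sum => j _.
have /andP[h1 h2] := H i j; apply: ler_pM => //.
by apply: coef_prod_ge0 => i' j'; case/andP: (H i' j').
Qed.

(** Coefficientwise comparison of the product of the [1 + y j X] with the product of the truncated
    exponentials of the [y j X]. *)
Lemma elementary_sym_le (R : realType) (n l : nat) (y : 'I_n -> R) :
  (forall j, 0 <= y j) ->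
  \sum_(J : {set 'I_n} | #|J| == l) \prod_(j in J) y j
    <= (\sum_j y j) ^+ l / l`!%:R.
Proof.
move=> y0; rewrite -(coef_prod_trunc_exp_poly _ _ _ y _ _ (leqnSn l)).
have E : (\prod_j (y j *: 'X + 1) : {poly R})`_l =
   \sum_(J : {set 'I_n} | #|J| == l) \prod_(j in J) y j.
  rewrite bigA_distr coef_sum big_mkcond /= [RHS]big_mkcond /=.
  apply: eq_bigr => J _.
  have -> : \prod_(i : 'I_n) (if i \in J then y i *: 'X else 1) =
     (\prod_(j in J) y j) *: 'X^#|J| :> {poly R}.
    by rewrite -big_mkcond /= scaler_prod prodr_const.
  rewrite coefZ coefXn eq_sym; case: (#|J| == l); by rewrite ?mulr1 ?mulr0.
rewrite -E; apply: coef_prod_le => i j.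
rewrite coefD coefZ coefX coef1 coef_poly.
case: j => [|[|j]] /=; rewrite ?mulr0 ?mulr1 ?addr0 ?add0r ?expr0 ?fact0 ?divr1.
- by rewrite ler01 lexx.
- by rewrite expr1 y0 lexx.
- by case: ifP => _; rewrite lexx // divr_ge0 ?exprn_ge0.
Qed.

(** * Sparse signs and the moments of one row form *)

Definition even_weight {R : realType} (p : R) (a : nat) : R :=
  if odd a then 0 else if a == 0%N then 1 else p.

Definition sparse_sign_weight {R : realType} (p : R) (o : option bool) : R :=
  if o is Some _ then p / 2 else 1 - p.

Definition sparse_sign {R : realType} (o : option bool) : R :=
  if o is Some b then (-1) ^+ b else 0.

Lemma sparse_sign_moment (R : realType) (p : R) a :
  \sum_o sparse_sign_weight p o * sparse_sign o ^+ a = even_weight p a.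
Proof.
rewrite (bigD1 None) //= (bigD1 (Some true)) //= (bigD1 (Some false)) //= big1.
  rewrite /even_weight expr1 expr0 expr1n expr0n.
  have [->|a0] := eqVneq a 0%N; first by rewrite expr0 /=; lra.
  rewrite -signr_odd; case: (odd a); rewrite ?expr1 ?expr0 /=; lra.
by case=> [[]|].
Qed.

Lemma even_weight_ge0 (R : realType) (p : R) a : 0 <= p -> 0 <= even_weight p a.
Proof. by rewrite /even_weight; case: ifP => // _; case: ifP. Qed.

(** The choices [g] of [k] pairs are grouped by the set [J] of columns they meet. A nonzero term
    meets each column of [J] at least twice: two factors per column are kept as [x j ^+ 2], and the
    other [2 * (k - l)] are bounded by [mu]. There are [l ^ (2 * k)] choices of pairs inside [J],
    and the products of squares sum to at most [1 / l!] by [elementary_sym_le]. *)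
Lemma row_moment_le (R : realType) (n k : nat) (p mu : R) (x : 'I_n -> R) :
  (0 < k)%N -> 0 <= p -> 0 <= mu ->
  (forall j, 0 <= x j <= mu) -> \sum_j x j ^+ 2 = 1 ->
  \sum_(g : {ffun 'I_k -> 'I_n * 'I_n})
     (\prod_i (((g i).1 != (g i).2)%:R * (x (g i).1 * x (g i).2))) *
     \prod_j even_weight p (\sum_i pair_exponent (g i) j)%N
  <= \sum_(2 <= l < k.+1) p ^+ l * mu ^+ (2 * (k - l)) * l%:R ^+ (2 * k) / l`!%:R.
Proof.
move=> k0 p0 mu0 hx hx1.
pose c (l : nat) : R := p ^+ l * mu ^+ (2 * (k - l)).
have c0 l : 0 <= c l by rewrite mulr_ge0 ?exprn_ge0.
(* Membership only requires the pairs to lie in [J], not to exhaust it. The extra terms are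
   nonnegative, and the number of such [g] is exactly [(#|J| ^ 2) ^ k]. *)
pose inJ (g : {ffun 'I_k -> 'I_n * 'I_n}) (J : {set 'I_n}) :=
  g \in ffun_on (mem (setX J J)).
have x2 j : 0 <= x j ^+ 2 by rewrite sqr_ge0.
have px2 (J : {set 'I_n}) : 0 <= \prod_(j in J) x j ^+ 2 by exact: prodr_ge0.
have pos g l J : 0 <= (inJ g J)%:R * (c l * \prod_(j in J) x j ^+ 2).
  by apply: mulr_ge0 => //; apply: mulr_ge0.
apply: (@le_trans _ _ (\sum_g \sum_(l < k.+1 | (2 <= l)%N)
   \sum_(J : {set 'I_n} | #|J| == l)
      (inJ g J)%:R * (c l * \prod_(j in J) x j ^+ 2))).
  apply: ler_sum => g _.
  have rhs0 : 0 <= \sum_(l < k.+1 | (2 <= l)%N)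
     \sum_(J : {set 'I_n} | #|J| == l)
        (inJ g J)%:R * (c l * \prod_(j in J) x j ^+ 2).
    by apply: sumr_ge0 => l _; apply: sumr_ge0.
  set al := fun j => (\sum_i pair_exponent (g i) j)%N.
  case: (boolP [forall i, (g i).1 != (g i).2]) => [/forallP hne|]; last first.
    rewrite negb_forall => /existsP[i /negPn /eqP hi].
    by rewrite (bigD1 i) //= hi eqxx !mul0r.
  case: (boolP [forall j, ~~ odd (al j)]) => [/forallP hev|]; last first.
    rewrite negb_forall => /existsP[j /negPn hj].
    by rewrite [X in _ * X](bigD1 j) //= /even_weight hj mul0r mulr0.
  pose J := [set j | al j != 0%N].
  have memJ i : ((g i).1 \in J) && ((g i).2 \in J).
    rewrite !inE /al (bigD1 i) //= [in X in _ && X](bigD1 i) //= /pair_exponent.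
    by rewrite -!lt0n !addn_gt0 !eqxx /= !orbT.
  have sal : (\sum_j al j = 2 * k)%N.
    rewrite /al exchange_big /= (eq_bigr (fun=> 2%N)) => [|i _].
      by rewrite sum_nat_const card_ord mulnC.
    exact: sum_pair_exponent.
  have al2 j : j \in J -> (2 <= al j)%N.
    rewrite inE; have := hev j; by case: (al j) => [|[|]].
  have salJ : (\sum_(j in J) al j = 2 * k)%N.
    rewrite -sal [RHS](bigID (mem J)) /= [X in (_ + X)%N]big1 ?addn0 // => j.
    by rewrite inE negbK => /eqP.
  have hJsum : (\sum_(j in J) (al j - 2) + 2 * #|J| = 2 * k)%N.
    rewrite -salJ (mulnC 2) -sum_nat_const -big_split /=.
    by apply: eq_bigr => j /al2; lia.
  (* The two columns of a single pair are already distinct; this is where [0 < k] matters. *)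
  have J2 : (2 <= #|J|)%N.
    have /andP[h1 h2] := memJ (Ordinal k0).
    have := hne (Ordinal k0) => h.
    rewrite -[2%N](_ : #|[set (g (Ordinal k0)).1; (g (Ordinal k0)).2]| = 2%N).
      by apply: subset_leq_card; rewrite subUset !sub1set h1 h2.
    by rewrite cards2 h.
  have Jk : (#|J| < k.+1)%N by lia.
  have inJg : inJ g J by apply/ffun_onP => i; rewrite inE memJ.
  apply: (@le_trans _ _ ((inJ g J)%:R * (c #|J| * \prod_(j in J) x j ^+ 2)));
    last first.
    rewrite (bigD1 (Ordinal Jk)) //= (bigD1 J) //= -addrA lerDl.
    by apply: addr_ge0; last apply: sumr_ge0 => l _; apply: sumr_ge0.
  rewrite inJg mul1r.
  have -> : \prod_i (((g i).1 != (g i).2)%:R * (x (g i).1 * x (g i).2)) =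
     \prod_j x j ^+ al j.
    rewrite (eq_bigr (fun i => \prod_j x j ^+ pair_exponent (g i) j)) => [|i _].
      by rewrite exchange_big /=; apply: eq_bigr => j _; rewrite expr_sum.
    by rewrite hne mul1r prod_pair_exponent.
  have -> : \prod_j even_weight p (al j) = p ^+ #|J|.
    rewrite -prodr_const [RHS]big_mkcond /=; apply: eq_bigr => j _.
    by rewrite /even_weight (negbTE (hev j)) inE; case: (al j).
  have -> : \prod_j x j ^+ al j = \prod_(j in J) x j ^+ al j.
    rewrite [RHS]big_mkcond /=; apply: eq_bigr => j _.
    by rewrite inE; case: eqP => //= ->.
  rewrite mulrC /c -mulrA; apply: ler_wpM2l; first exact: exprn_ge0.
  have -> : mu ^+ (2 * (k - #|J|)) = \prod_(j in J) mu ^+ (al j - 2).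
    rewrite -expr_sum; congr (_ ^+ _).
    by move: hJsum; set t := (\sum_(j in J) _)%N; lia.
  rewrite -big_split /=; apply: ler_prod => j jJ.
  have /andP[xj0 xjm] := hx j.
  rewrite exprn_ge0 //= -{1}(subnK (al2 j jJ)) exprD.
  by apply: ler_wpM2r => //; rewrite lerXn2r.
rewrite exchange_big /= big_mkcond /=.
rewrite (big_nat_widenl 2 0) // big_mkord [leRHS]big_mkcond /=.
apply: ler_sum => l _; case: ifP => // l2; rewrite exchange_big /=.
apply: (@le_trans _ _ (\sum_(J : {set 'I_n} | #|J| == l)
    (l%:R ^+ (2 * k) * (c l * \prod_(j in J) x j ^+ 2)))).
  apply: ler_sum => J /eqP hJ; rewrite -mulr_suml; apply: ler_wpM2r.
    exact: mulr_ge0.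
  have -> : \sum_g (inJ g J)%:R = (#|setX J J| ^ k)%:R :> R.
    rewrite -[X in (_ ^ X)%N](card_ord k) -card_ffun_on -sum1_card natr_sum.
    by rewrite [RHS]big_mkcond /=; apply: eq_bigr => g _; rewrite /inJ; case: (g \in _).
  by rewrite cardsX hJ natrX natrM -expr2 exprM.
rewrite -!mulr_sumr.
have := elementary_sym_le R n l (fun j => x j ^+ 2) x2; rewrite hx1 expr1n div1r => h.
rewrite mulrA [X in X * _]mulrC; apply: ler_wpM2l => //.
by rewrite mulr_ge0 // exprn_ge0.
Qed.

(** * Hashing columns: moments and domination *)

Lemma rows_sample_inj m s (f : rows_sample m s) : injective (val f).
Proof. by apply/injectiveP; exact: valP f. Qed.

Definition hitting {m s : nat} (T : {set 'I_m}) : {set rows_sample m s} :=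
  [set f : rows_sample m s | [forall i in T, [exists k, val f k == i]]].

Lemma rows_sample_perm_subproof m s (t : {perm 'I_m}) (f : rows_sample m s) :
  injectiveb [ffun k => t (val f k)].
Proof.
by apply/injectiveP => k k'; rewrite !ffunE => /perm_inj /rows_sample_inj.
Qed.

Definition rows_sample_perm {m s} (t : {perm 'I_m}) (f : rows_sample m s) :
  rows_sample m s :=
  exist (fun f : {ffun 'I_s -> 'I_m} => injectiveb f) _ (rows_sample_perm_subproof m s t f).

Lemma rows_sample_perm_inj m s (t : {perm 'I_m}) :
  injective (@rows_sample_perm m s t).
Proof.
move=> f g /(congr1 val) /ffunP h; apply: val_inj; apply/ffunP => k.
by have := h k; rewrite !ffunE => /perm_inj.
Qed.

(** Composition with the transposition of [i] and [i'], which fixes [T] pointwise, maps one family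
    injectively into the other. *)
Lemma hitting_setU1_exchange m s (T : {set 'I_m}) (i i' : 'I_m) :
  i \notin T -> i' \notin T ->
  (#|@hitting m s (i |: T)| <= #|@hitting m s (i' |: T)|)%N.
Proof.
move=> iT i'T; rewrite -(card_imset _ (@rows_sample_perm_inj m s (tperm i i'))).
apply/subset_leq_card/subsetP => _ /imsetP[f + ->]; rewrite !inE.
move=> /'forall_implyP h; apply/'forall_implyP => j.
have ex u : u \in i |: T -> [exists k, val (rows_sample_perm (tperm i i') f) k == tperm i i' u].
  move=> /h /existsP[k /eqP hk]; apply/existsP; exists k.
  by rewrite /= ffunE hk.
rewrite !inE => /orP[/eqP ->|jT].
  by rewrite -{2}(tpermL i i'); apply: ex; rewrite !inE eqxx.
have {1}-> : j = tperm i i' j.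
  by rewrite tpermD //; [apply: contraNneq iT | apply: contraNneq i'T] => ->.
by apply: ex; rewrite !inE jT orbT.
Qed.

(* Summing over all [i' \notin T], which are exchangeable, counts each sample
   hitting [T] exactly [s - #|T|] times. *)
Lemma hitting_setU1_le m s (T : {set 'I_m}) (i : 'I_m) :
  (s <= m)%N -> i \notin T ->
  (m * #|@hitting m s (i |: T)| <= s * #|@hitting m s T|)%N.
Proof.
move=> sm iT.
have tm : (#|T| < m)%N.
  rewrite -[X in (_ < X)%N](card_ord m) -cardsT; apply: proper_card.
  by apply/properP; split; [exact: subsetT | exists i].
have H : ((m - #|T|) * #|@hitting m s (i |: T)| <= (s - #|T|) * #|@hitting m s T|)%N.
  have -> : (m - #|T| = #|~: T|)%N by rewrite [RHS]cardsCs setCK card_ord.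
  rewrite -sum_nat_const.
  apply: (@leq_trans (\sum_(i' in ~: T) #|@hitting m s (i' |: T)|)).
    by apply: leq_sum => i'; rewrite inE => i'T; exact: hitting_setU1_exchange.
  rewrite (eq_bigr (fun i' => \sum_(f in @hitting m s T)
     nat_of_bool (i' \in [set val f k | k in 'I_s]))%N) => [|i' _]; last first.
    rewrite -sum1_card big_mkcond [RHS]big_mkcond /=; apply: eq_bigr => f _.
    rewrite !inE.
    have -> : [forall j in i' |: T, [exists k, val f k == j]] =
       [forall j in T, [exists k, val f k == j]] && (i' \in [set val f k | k in 'I_s]).
      apply/'forall_implyP/andP => [h|[/'forall_implyP h /imsetP[k _ hk]] j].
        split.
          by apply/'forall_implyP => j jT; apply: h; rewrite !inE jT orbT.
        have /existsP[k /eqP <-] : [exists k, val f k == i'].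
          by apply: h; rewrite !inE eqxx.
        exact: imset_f.
      rewrite !inE => /orP[/eqP ->|/h //].
      by apply/existsP; exists k; rewrite hk.
    by move: [forall j in T, _] (i' \in _) => [] [].
  rewrite exchange_big /= mulnC -sum_nat_const; apply: leq_sum => f.
  rewrite inE => /'forall_implyP h.
  rewrite -big_mkcondr /= sum1_card.
  have TS : T \subset [set val f k | k in 'I_s].
    apply/subsetP => j /h /existsP[k /eqP <-]; exact: imset_f.
  have -> : #|[pred i' | (i' \in ~: T) && (i' \in [set val f k | k in 'I_s])]| =
     #|[set val f k | k in 'I_s] :\: T|.
    by apply: eq_card => j; rewrite !inE.
  rewrite cardsD (setIidPr TS) card_imset ?card_ord //.
  exact: rows_sample_inj.
move: H tm sm.
move: #|hitting (i |: T)| #|hitting T| #|T| => a b t H tm sm.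
(* It remains to weaken [(s - t) / (m - t)] to [s / m], which is valid because [s <= m]. *)
rewrite -(@leq_pmul2l (m - t)); last by rewrite subn_gt0.
apply: (@leq_trans (m * ((s - t) * b))).
  by rewrite mulnCA leq_mul2l H orbT.
rewrite !mulnA leq_mul2r; apply/orP; right.
by rewrite mulnBr mulnBl leq_sub2l // (mulnC m t) leq_mul2l sm orbT.
Qed.

(** Sampling without replacement hits the rows of [T] with negative dependence: removing them one at
    a time, each costs a factor [s / m]. *)
Lemma hitting_le m s (T : {set 'I_m}) :
  (s <= m)%N ->
  (m ^ #|T| * #|@hitting m s T| <= s ^ #|T| * #|rows_sample m s|)%N.
Proof.
move=> sm; move en: #|T| => t; elim: t T en => [|t IH] T hT.
  by rewrite !expn0 !mul1n max_card.
have : (0 < #|T|)%N by rewrite hT.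
case/card_gt0P => i iT.
have hT' : #|T :\ i| = t by move: (cardsD1 i T); rewrite iT hT; lia.
have := IH _ hT'; have := @hitting_setU1_le m s (T :\ i) i sm.
rewrite setD1K // !inE eqxx => /(_ isT).
rewrite !expnS.
move: #|@hitting m s T| #|@hitting m s (T :\ i)| => a b h1 h2.
rewrite [(m * _)%N]mulnC -mulnA; apply: (@leq_trans (m ^ t * (s * b))).
  by rewrite leq_mul2l h1 orbT.
by rewrite mulnCA -mulnA leq_mul2l h2 orbT.
Qed.

(** An entry of the hashing matrix without its factor [1 / sqrt s], so that its values are -1, 0 and
    1. *)
Definition column_entry {R : realType} {m s : nat}
    (c : rows_sample m s * {ffun 'I_s -> bool}) (i : 'I_m) : R :=
  \sum_(k < s | val c.1 k == i) (-1) ^+ (c.2 k).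

Lemma column_entry_hit (R : realType) m s
    (c : rows_sample m s * {ffun 'I_s -> bool}) k :
  column_entry c (val c.1 k) = (-1) ^+ (c.2 k) :> R.
Proof.
rewrite /column_entry (big_pred1 k) // => k' /=.
by apply/eqP/eqP => [/rows_sample_inj|->].
Qed.

Lemma column_entry_miss (R : realType) m s
    (c : rows_sample m s * {ffun 'I_s -> bool}) i :
  ~~ [exists k, val c.1 k == i] -> column_entry c i = 0 :> R.
Proof.
by rewrite negb_exists => /forallP h; rewrite /column_entry big1 // => k; rewrite (negbTE (h k)).
Qed.

Lemma prod_column_entry (R : realType) m s (al : 'I_m -> nat)
    (f : rows_sample m s) (b : {ffun 'I_s -> bool}) :
  \prod_i (column_entry (f, b) i : R) ^+ al i =
  (f \in hitting [set i | al i != 0%N])%:R * \prod_k (-1) ^+ (b k * al (val f k)).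
Proof.
rewrite inE; case: (boolP [forall i in _, _]) => [/'forall_implyP h|]; last first.
  rewrite negb_forall => /existsP[i]; rewrite negb_imply inE => /andP[ai hi].
  by rewrite (bigD1 i) //= column_entry_miss // expr0n (negbTE ai) !mul0r.
rewrite mul1r (bigID (mem [set val f k | k in 'I_s])) /= [X in _ * X]big1 ?mulr1.
  rewrite big_imset /=; last by move=> k k' _ _ /rows_sample_inj.
  apply: eq_bigr => k _.
  by rewrite (column_entry_hit R _ _ (f, b)) exprM.
move=> i hi; have [->|ai] := eqVneq (al i) 0%N; first by rewrite expr0.
have /existsP[k /eqP hk] : [exists k, val f k == i] by apply: h; rewrite inE.
by move: hi; rewrite -hk imset_f.
Qed.

(** Averaging over the signs gives zero when a sampled row has an odd exponent. If all exponents are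
    even, what remains is the probability that the sample hits every row with a nonzero exponent,
    which [hitting_le] bounds. *)
Lemma column_moment (R : realType) m s (al : 'I_m -> nat) :
  (0 < m)%N -> (s <= m)%N ->
  0 <= #|{: rows_sample m s * {ffun 'I_s -> bool}}|%:R^-1 *
    \sum_(c : rows_sample m s * {ffun 'I_s -> bool})
       \prod_i (column_entry c i : R) ^+ al i
  <= \prod_i even_weight (s%:R / m%:R) (al i).
Proof.
move=> m0 sm; set T := [set i | al i != 0%N].
have p0 : 0 <= s%:R / m%:R :> R by rewrite divr_ge0.
have E : \sum_(c : rows_sample m s * {ffun 'I_s -> bool})
       \prod_i (column_entry c i : R) ^+ al i =
    \sum_(f in @hitting m s T) \prod_(k < s) (if odd (al (val f k)) then 0 else 2).
  rewrite -(pair_bigA _ (fun f b => \prod_i (column_entry (f, b) i : R) ^+ al i)) /=.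
  rewrite [RHS]big_mkcond /=; apply: eq_bigr => f _.
  under eq_bigr => b _ do rewrite prod_column_entry.
  rewrite -mulr_sumr; case: (f \in _); last by rewrite mul0r.
  rewrite mul1r -(bigA_distr_bigA (fun k (b : bool) => (-1) ^+ (b * al (val f k)))) /=.
  apply: eq_bigr => k _; rewrite big_bool /= mul1n mul0n expr0 -signr_odd.
  by case: (odd _); rewrite ?expr1 ?expr0; lra.
rewrite E.
(* An odd exponent is nonzero, so its row lies in [T] and is sampled by every [f] in the sum: each
   product contains a zero factor. *)
case: (boolP [forall i, ~~ odd (al i)]) => [/forallP hev|]; last first.
  rewrite negb_forall => /existsP[i /negPn hi].
  rewrite big1 ?mulr0 ?lexx /=.
    by apply: prodr_ge0 => j _; exact: even_weight_ge0.
  move=> f; rewrite inE => /'forall_implyP h.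
  have /existsP[k /eqP hk] : [exists k, val f k == i].
    by apply: h; rewrite inE; case: (al i) hi.
  by rewrite (bigD1 k) //= hk hi mul0r.
have -> : \prod_i even_weight (s%:R / m%:R) (al i) = (s%:R / m%:R) ^+ #|T| :> R.
  rewrite -prodr_const [RHS]big_mkcond /=; apply: eq_bigr => j _.
  by rewrite /even_weight (negbTE (hev j)) inE; case: (al j).
rewrite (eq_bigr (fun=> 2 ^+ s)) => [|f _]; last first.
  rewrite (eq_bigr (fun=> 2)) ?prodr_ord // => k _.
  by rewrite (negbTE (hev _)).
rewrite sumr_const card_prod card_ffun card_bool card_ord.
have := @hitting_le m s T sm; move: #|hitting T| #|rows_sample m s| => a b hab.
rewrite natrM natrX invfM -(mulr_natr (2 ^+ s)).
have -> : b%:R^-1 / 2 ^+ s * (2 ^+ s * a%:R) = a%:R / b%:R :> R.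
  have h2 : 2 ^+ s != 0 :> R by rewrite expf_eq0 pnatr_eq0 andbF.
  by move: b%:R^-1 => bi; field.
rewrite divr_ge0 //= expr_div_n.
case: b hab => [|b] hab; first by rewrite invr0 mulr0 divr_ge0 // exprn_ge0.
rewrite ler_pdivrMr ?ltr0n // mulrAC ler_pdivlMr; last first.
  by rewrite exprn_gt0 // ltr0n.
by rewrite -!natrX -!natrM ler_nat mulnC.
Qed.

(** * Comparison with independent sparse signs *)

Lemma prod_pairE (R : comNzRingType) (I J : finType) (F : I * J -> R) :
  \prod_e F e = \prod_i \prod_j F (i, j).
Proof. by rewrite pair_bigA; apply: eq_bigr => -[]. Qed.

Lemma sum_ffun_prod2 (R : realType) (I J T : finType) (F : I -> J -> T -> R) :
  \sum_(z : {ffun I -> {ffun J -> T}}) \prod_i \prod_j F i j (z i j) =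
  \prod_i \prod_j \sum_o F i j o.
Proof.
rewrite -(bigA_distr_bigA (fun i (z : {ffun J -> T}) => \prod_j F i j (z j))) /=.
by apply: eq_bigr => i _; rewrite -bigA_distr_bigA.
Qed.

(** The left-hand moment factors over the independent columns, the right-hand one over all entries;
    [column_moment] compares the factors column by column. *)
Lemma hashing_domination (R : realType) (m n s : nat) (al : 'I_m * 'I_n -> nat) :
  (0 < m)%N -> (s <= m)%N ->
  0 <= \sum_(w : hashing_sample m n s) #|hashing_sample m n s|%:R^-1 *
         \prod_e (column_entry (w e.2) e.1 : R) ^+ al e
    <= \sum_(z : {ffun 'I_m -> {ffun 'I_n -> option bool}})
         (\prod_i \prod_j sparse_sign_weight (s%:R / m%:R) (z i j)) *
         \prod_e (sparse_sign (z e.1 e.2) : R) ^+ al e.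
Proof.
move=> m0 sm.
have -> : \sum_(z : {ffun 'I_m -> {ffun 'I_n -> option bool}})
         (\prod_i \prod_j sparse_sign_weight (s%:R / m%:R) (z i j)) *
         \prod_e (sparse_sign (z e.1 e.2) : R) ^+ al e =
   \prod_i \prod_j even_weight (s%:R / m%:R) (al (i, j)).
  transitivity (\sum_(z : {ffun 'I_m -> {ffun 'I_n -> option bool}})
      \prod_i \prod_j (sparse_sign_weight (s%:R / m%:R) (z i j) *
         sparse_sign (z i j) ^+ al (i, j)) : R).
    apply: eq_bigr => z _.
    rewrite prod_pairE /=.
    by rewrite -big_split /=; apply: eq_bigr => i _; rewrite big_split.
  rewrite (sum_ffun_prod2 _ _ _ _ (fun i j o => sparse_sign_weight (s%:R / m%:R) o *
    sparse_sign o ^+ al (i, j))).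
  by apply: eq_bigr => i _; apply: eq_bigr => j _; rewrite sparse_sign_moment.
rewrite -mulr_sumr.
have -> : #|hashing_sample m n s|%:R^-1 *
   (\sum_(w : hashing_sample m n s)
     \prod_e (column_entry (w e.2) e.1 : R) ^+ al e) =
   \prod_j (#|{: rows_sample m s * {ffun 'I_s -> bool}}|%:R^-1 *
    \sum_(c : rows_sample m s * {ffun 'I_s -> bool})
       \prod_i (column_entry c i : R) ^+ al (i, j)).
  rewrite big_split /= prodr_ord card_ffun card_ord natrX exprVn; congr (_ * _).
  rewrite bigA_distr_bigA /=; apply: eq_bigr => w _.
  rewrite prod_pairE /=.
  by rewrite exchange_big.
apply/andP; split.
  apply: prodr_ge0 => j _.
  by have /andP[] := @column_moment R m s (fun i => al (i, j)) m0 sm.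
rewrite exchange_big /=; apply: ler_prod => j _.
exact: column_moment.
Qed.

Definition off_diagonal {R : realType} {n : nat} (x v : 'I_n -> R) : R :=
  \sum_(t : 'I_n * 'I_n) (t.1 != t.2)%:R * (x t.1 * x t.2) * (v t.1 * v t.2).

(** The whole form is one polynomial in the entries, with monomials indexed by a row and a pair of
    columns, so [moment_domination] applies. The absolute values of [x] come from there. *)
Lemma hashing_moment_le_indep (R : realType) (m n s q : nat) (x : 'I_n -> R) :
  (0 < m)%N -> (s <= m)%N ->
  #|hashing_sample m n s|%:R^-1 * (\sum_(w : hashing_sample m n s)
     (\sum_i off_diagonal x (fun j => column_entry (w j) i)) ^+ q)
  <= \sum_(z : {ffun 'I_m -> {ffun 'I_n -> option bool}})
         (\prod_i \prod_j sparse_sign_weight (s%:R / m%:R) (z i j)) *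
         (\sum_i off_diagonal (fun j => `|x j|) (fun j => sparse_sign (z i j))) ^+ q.
Proof.
move=> m0 sm.
pose u (t : 'I_m * ('I_n * 'I_n)) : R :=
  (t.2.1 != t.2.2)%:R * (x t.2.1 * x t.2.2).
pose a (t : 'I_m * ('I_n * 'I_n)) (e : 'I_m * 'I_n) :=
  ((e.1 == t.1) * pair_exponent t.2 e.2)%N.
have prodE (F : 'I_m -> 'I_n -> R) t :
    \prod_e F e.1 e.2 ^+ a t e = F t.1 t.2.1 * F t.1 t.2.2.
  rewrite prod_pairE /=.
  rewrite (bigD1 t.1) //= [X in _ * X]big1 => [|i /negbTE hi].
    rewrite mulr1 -(@prod_pair_exponent R n (F t.1) t.2).
    by apply: eq_bigr => j _; rewrite /a /= eqxx mul1n.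
  by apply: big1 => j _; rewrite /a /= hi mul0n expr0.
rewrite mulr_sumr.
have -> : \sum_(w : hashing_sample m n s) #|hashing_sample m n s|%:R^-1 *
     (\sum_i off_diagonal x (fun j => column_entry (w j) i)) ^+ q =
   \sum_(w : hashing_sample m n s) #|hashing_sample m n s|%:R^-1 *
     (\sum_t u t * \prod_e (column_entry (w e.2) e.1) ^+ a t e) ^+ q.
  apply: eq_bigr => w _; congr (_ * _ ^+ _).
  rewrite /off_diagonal pair_bigA /=; apply: eq_bigr => t _.
  by rewrite (prodE (fun i j => column_entry (w j) i)).
have -> : \sum_(z : {ffun 'I_m -> {ffun 'I_n -> option bool}})
         (\prod_i \prod_j sparse_sign_weight (s%:R / m%:R) (z i j)) *
         (\sum_i off_diagonal (fun j => `|x j|) (fun j => sparse_sign (z i j))) ^+ q =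
   \sum_(z : {ffun 'I_m -> {ffun 'I_n -> option bool}})
         (\prod_i \prod_j sparse_sign_weight (s%:R / m%:R) (z i j)) *
     (\sum_t `|u t| * \prod_e (sparse_sign (z e.1 e.2)) ^+ a t e) ^+ q.
  apply: eq_bigr => z _; congr (_ * _ ^+ _).
  rewrite /off_diagonal pair_bigA /=; apply: eq_bigr => t _.
  rewrite (prodE (fun i j => sparse_sign (z i j))) /u !normrM.
  by rewrite (ger0_norm (ler0n _ _)).
apply: moment_domination => al; exact: hashing_domination.
Qed.

Lemma exchange_big_triangle (R : realType) (q : nat) (F : nat -> nat -> R) :
  \sum_(1 <= k < q.+1) \sum_(2 <= l < k.+1) F k l =
  \sum_(2 <= l < q.+1) \sum_(l <= k < q.+1) F k l.
Proof.
have -> : \sum_(1 <= k < q.+1) \sum_(2 <= l < k.+1) F k l =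
   \sum_(1 <= k < q.+1) \sum_(2 <= l < q.+1 | (l <= k)%N) F k l.
  apply: eq_big_nat => k /andP[k1 kq].
  by rewrite (big_nat_widen 2 k.+1 q.+1) //; apply: eq_bigl => l; rewrite ltnS.
rewrite (exchange_big_dep_nat predT) //=; apply: eq_big_nat => l /andP[l2 lq].
by rewrite [RHS](big_nat_widenl l 1) // ltnW.
Qed.

(** In the independent model the rows are identically distributed, so [moment_iid_sum_le] reduces to
    a single row. Its moment of order 0 is 1, and [row_moment_le] bounds the others, whose weighted
    sum is at most [B] after exchanging [k] and [l]. *)
Lemma hashing_moment_le (R : realType) (m n s q : nat) (x : 'I_n -> R) (mu lam B : R) :
  (0 < m)%N -> (s <= m)%N -> 0 < lam -> 0 <= mu ->
  (forall j, `|x j| <= mu) -> \sum_j x j ^+ 2 = 1 ->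
  \sum_(2 <= l < q.+1) \sum_(l <= k < q.+1)
     lam ^+ k * ((s%:R / m%:R) ^+ l * mu ^+ (2 * (k - l)) * l%:R ^+ (2 * k)
       / l`!%:R) / k`!%:R <= B ->
  #|hashing_sample m n s|%:R^-1 * (\sum_(w : hashing_sample m n s)
     (\sum_i off_diagonal x (fun j => column_entry (w j) i)) ^+ q)
  <= q`!%:R / lam ^+ q * (1 + B) ^+ m.
Proof.
move=> m0 sm l0 mu0 hx x1 hB.
apply: le_trans (hashing_moment_le_indep R m n s q x m0 sm) _.
set p := s%:R / m%:R in hB *.
have p0 : 0 <= p by rewrite divr_ge0.
pose P (z : {ffun 'I_n -> option bool}) : R := \prod_j sparse_sign_weight p (z j).
pose Q (z : {ffun 'I_n -> option bool}) : R :=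
  off_diagonal (fun j => `|x j|) (fun j => sparse_sign (z j)).
have mom k : \sum_z P z * Q z ^+ k = \sum_(g : {ffun 'I_k -> 'I_n * 'I_n})
     (\prod_i (((g i).1 != (g i).2)%:R * (`|x (g i).1| * `|x (g i).2|))) *
     \prod_j even_weight p (\sum_i pair_exponent (g i) j)%N.
  transitivity (\sum_z P z * (\sum_(t : 'I_n * 'I_n)
      ((t.1 != t.2)%:R * (`|x t.1| * `|x t.2|)) *
      \prod_j (sparse_sign (z j)) ^+ pair_exponent t j) ^+ k).
    apply: eq_bigr => z _; congr (_ * _ ^+ _); apply: eq_bigr => t _.
    by rewrite (@prod_pair_exponent R n (fun j => sparse_sign (z j))).
  rewrite moment_expand; apply: eq_bigr => g _; congr (_ * _).
  under [RHS]eq_bigr => j _ do rewrite -sparse_sign_moment.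
  by rewrite bigA_distr_bigA /=; apply: eq_bigr => z _; rewrite -big_split.
have mom0 k : 0 <= \sum_z P z * Q z ^+ k.
  rewrite mom; apply: sumr_ge0 => g _; apply: mulr_ge0.
    by apply: prodr_ge0 => i _; rewrite !mulr_ge0.
  by apply: prodr_ge0 => j _; exact: even_weight_ge0.
apply: le_trans (moment_iid_sum_le R _ m q P Q lam l0 mom0) _.
apply: ler_wpM2l; first by rewrite divr_ge0 // exprn_ge0 // ltW.
have t0 k : 0 <= lam ^+ k * (\sum_z P z * Q z ^+ k) / k`!%:R.
  by rewrite divr_ge0 // mulr_ge0 // exprn_ge0 // ltW.
have E0 : \sum_z P z * Q z ^+ 0 = 1.
  under eq_bigr => z _ do rewrite expr0 mulr1.
  rewrite -(bigA_distr_bigA (fun j o => sparse_sign_weight p o)) /=.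
  apply: big1 => j _; rewrite -[RHS](_ : even_weight p 0 = 1) //.
  by rewrite -sparse_sign_moment; apply: eq_bigr => o _; rewrite expr0 mulr1.
have le1 : \sum_(k < q.+1) lam ^+ k * (\sum_z P z * Q z ^+ k) / k`!%:R <= 1 + B.
  rewrite big_ord_recl /= expr0 mul1r E0 fact0 divr1 lerD2l.
  apply: le_trans hB; rewrite -exchange_big_triangle big_add1 /= big_mkord.
  apply: ler_sum => k _; rewrite /bump add1n.
  rewrite -mulr_suml -mulr_sumr.
  apply: ler_wpM2r; first by rewrite invr_ge0.
  apply: ler_wpM2l; first by rewrite exprn_ge0 // ltW.
  rewrite mom; apply: (@row_moment_le R n k.+1 p mu (fun j => `|x j|)) => // [j|].
    by rewrite normr_ge0 hx.
  by rewrite -x1; apply: eq_bigr => j _; rewrite real_normK // num_real.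
have B1 : 0 <= \sum_(k < q.+1) lam ^+ k * (\sum_z P z * Q z ^+ k) / k`!%:R.
  exact: sumr_ge0.
by apply: lerXn2r; rewrite // nnegrE // (le_trans B1 le1).
Qed.

(** * The distortion of a single vector *)

Lemma norm2_sqr (R : realType) n (v : 'cV[R]_n) :
  norm2 v ^+ 2 = \sum_i v i 0 ^+ 2.
Proof. by rewrite sqr_sqrtr // sumr_ge0 // => i _; rewrite sqr_ge0. Qed.

Lemma sum_column_entry_sqr (R : realType) m s
    (c : rows_sample m s * {ffun 'I_s -> bool}) :
  \sum_i column_entry c i ^+ 2 = s%:R :> R.
Proof.
rewrite (bigID (mem [set val c.1 k | k in 'I_s])) /= [X in _ + X]big1 ?addr0.
  rewrite big_imset /=; last by move=> k k' _ _ /rows_sample_inj.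
  rewrite (eq_bigr (fun=> 1)) ?sumr_const ?card_ord // => k _.
  by rewrite column_entry_hit sqrr_sign.
move=> i hi; rewrite column_entry_miss ?expr0n //.
apply: contra hi => /existsP[k /eqP <-]; exact: imset_f.
Qed.

Lemma sqr_sum_off_diagonal (R : realType) n (x v : 'I_n -> R) :
  (\sum_j v j * x j) ^+ 2 = off_diagonal x v + \sum_j (v j * x j) ^+ 2.
Proof.
rewrite expr2 big_distrlr /= pair_bigA /=.
rewrite (bigID (fun t : 'I_n * 'I_n => t.1 != t.2)) /=; congr (_ + _).
  rewrite /off_diagonal big_mkcond /=; apply: eq_bigr => t _.
  by case: (t.1 != t.2); rewrite ?mul1r ?mul0r //; ring.
transitivity (\sum_i \sum_(j | i == j) v i * x i * (v j * x j)).
  rewrite pair_big_dep /=; apply: eq_bigl => t; by rewrite negbK.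
by apply: eq_bigr => j _; rewrite (big_pred1 j) ?expr2 // => i; rewrite /= eq_sym.
Qed.

(** Every column has exactly [s] entries of square 1, so the diagonal part of the squared norm is
    deterministic and cancels. *)
Lemma hashing_norm_dev (R : realType) m n s (w : hashing_sample m n s)
    (x : 'cV[R]_n) :
  (0 < s)%N ->
  \sum_i off_diagonal (fun j => x j 0) (fun j => column_entry (w j) i) =
  s%:R * (norm2 (hashing_mx R w *m x) ^+ 2 - norm2 x ^+ 2).
Proof.
move=> s0.
have sR : 0 < s%:R :> R by rewrite ltr0n.
have sq : Num.sqrt s%:R ^+ 2 = s%:R :> R by rewrite sqr_sqrtr.
have sq0 : Num.sqrt s%:R != 0 :> R by rewrite sqrtr_eq0 -ltNge.
have hx i : (hashing_mx R w *m x) i 0 =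
    (\sum_j column_entry (w j) i * x j 0) / Num.sqrt s%:R.
  rewrite mxE mulr_suml; apply: eq_bigr => j _; rewrite mxE.
  by rewrite -mulr_suml mulrAC.
rewrite mulrBr !norm2_sqr.
have -> : s%:R * (\sum_i (hashing_mx R w *m x) i 0 ^+ 2) =
    \sum_i (\sum_j column_entry (w j) i * x j 0) ^+ 2.
  rewrite mulr_sumr; apply: eq_bigr => i _.
  by rewrite hx expr_div_n sq mulrCA divff ?mulr1 // gt_eqF.
have -> : s%:R * (\sum_j x j 0 ^+ 2) =
    \sum_i \sum_j (column_entry (w j) i * x j 0) ^+ 2.
  rewrite mulr_sumr exchange_big /=; apply: eq_bigr => j _.
  under eq_bigr => i _ do rewrite exprMn.
  by rewrite -mulr_suml sum_column_entry_sqr.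
rewrite -sumrB; apply: eq_bigr => i _.
by rewrite (sqr_sum_off_diagonal _ _ (fun j => x j 0)) addrK.
Qed.

Lemma fact_le_expn (q : nat) : (q`! <= q ^ q)%N.
Proof.
elim: q => // q IH; rewrite factS expnS leq_mul2l; apply/orP; right.
by apply: leq_trans IH _; case: q => // q; rewrite leq_exp2r.
Qed.

Lemma one_plus_div_expn_le (R : realType) (q m : nat) :
  (0 < m)%N -> (1 + q%:R / m%:R) ^+ m <= expR q%:R :> R.
Proof.
move=> m0; have mR : 0 < m%:R :> R by rewrite ltr0n.
have -> : expR q%:R = expR (q%:R / m%:R) ^+ m :> R.
  by rewrite -expRM_natl; congr expR; field; rewrite gt_eqF.
apply: lerXn2r; rewrite ?nnegrE ?expR_ge0 ?addr_ge0 ?divr_ge0 //.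
exact: expR_ge1Dx.
Qed.

(* A moment of order [q], optimised at the rate [rate_const * q / (eps * s)],
   contributes [(e / rate_const) ^ q = 4 ^ - q * e ^ (- 5 q)], where [4 ^ - q]
   pays for the accuracy [eps / 4] on the net and [e ^ (- 5 q)] for its size. *)
Definition rate_const {R : realType} : R := 4 * expR 6.
(** Chosen so that [rho = 2 * rate_const * accuracy_const] satisfies the condition
    [rho * expR 2 <= 1 / 2] of [double_sum_le] with equality. *)
Definition accuracy_const {R : realType} : R := (4 * rate_const * expR 2)^-1.

Lemma rate_const_gt0 (R : realType) : 0 < rate_const :> R.
Proof. by rewrite mulr_gt0 // expR_gt0. Qed.

Lemma accuracy_const_gt0 (R : realType) : 0 < accuracy_const :> R.
Proof. by rewrite invr_gt0 !mulr_gt0 ?rate_const_gt0 ?expR_gt0. Qed.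

Lemma accuracy_const_lt1 (R : realType) : accuracy_const < 1 :> R.
Proof.
have h6 := expR_ge1Dx (6:R); have h2 := expR_ge1Dx (2:R).
by rewrite invf_lt1 ?mulr_gt0 ?rate_const_gt0 ?expR_gt0 // /rate_const; nra.
Qed.

(** With [b = lam * mu ^+ 2] and [A = lam * s / m], the series is [A] times the sum in
    [double_sum_le]. The bound on [m] makes [A] small against [expR (- Lam)]; the first entry of the
    minimum controls [b] against [Lam ^+ 2 / q], and the second gives [expR (4 * b) <= E]. *)
Lemma moment_series_le (R : realType) (m s q : nat) (eps E L mu : R) :
  (0 < m)%N -> (0 < s)%N -> (0 < q)%N -> 0 < L ->
  L <= q%:R <= 2 * L -> 0 < eps < 1 -> 2 <= E ->
  E * accuracy_const ^- 2 * eps ^- 2 * L <= m%:R ->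
  0 <= mu ->
  mu ^+ 2 <= 144 * s%:R * (1 / 100) ^+ 2 * accuracy_const * eps *
    (Num.min (ln (E / (accuracy_const * eps)) / L) (Num.sqrt (ln E / L))) ^+ 2 ->
  \sum_(2 <= l < q.+1) \sum_(l <= k < q.+1)
     (rate_const * q%:R / (eps * s%:R)) ^+ k * ((s%:R / m%:R) ^+ l * mu ^+ (2 * (k - l)) *
        l%:R ^+ (2 * k) / l`!%:R) / k`!%:R <= q%:R / m%:R.
Proof.
move=> m0 s0 q0 L0 /andP[Lq qL] /andP[e0 e1] E2 hm mu0 hmu.
have mR : 0 < m%:R :> R by rewrite ltr0n.
have sR : 0 < s%:R :> R by rewrite ltr0n.
have qR : 0 < q%:R :> R by rewrite ltr0n.
have G0 := rate_const_gt0 R; have C0 := accuracy_const_gt0 R; have C1 := accuracy_const_lt1 R.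
set G := rate_const in G0 *; set C := accuracy_const in C0 C1 hm hmu *.
have E0 : 0 < E by lra.
have Ce0 : 0 < C * eps by rewrite mulr_gt0.
have Ce1 : C * eps < 1 by nra.
set Lam := ln (E / (C * eps)) in hmu.
have ECe1 : 1 < E / (C * eps) by rewrite ltr_pdivlMr //; lra.
have Lam0 : 0 < Lam by rewrite ln_gt0.
have eLam : expR (- Lam) = C * eps / E.
  by rewrite expRN lnK ?posrE ?divr_gt0 // invf_div.
set lam := G * q%:R / (eps * s%:R); set p := s%:R / m%:R.
have lam0 : 0 < lam by apply: divr_gt0; apply: mulr_gt0.
have p0 : 0 < p by rewrite divr_gt0.
set b := lam * mu ^+ 2; set A := lam * p.
have t0 : 0 < expR 2 :> R by exact: expR_gt0.
have t3 : 3 <= expR 2 :> R by have := expR_ge1Dx (2 : R); lra.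
have GC : G * C = (4 * expR 2)^-1.
  by rewrite /C /accuracy_const -/G; field; rewrite !gt_eqF.
have hA : A <= 2 * G * C * expR (- Lam).
  have -> : A = G * q%:R / (eps * m%:R) by rewrite /A /lam /p; field; rewrite !gt_eqF.
  rewrite eLam ler_pdivrMr ?mulr_gt0 //.
  have hm' : E * L <= m%:R * (C ^+ 2 * eps ^+ 2).
    move: hm; rewrite -ler_pdivrMr ?mulr_gt0 ?exprn_gt0 //.
    by move=> h; apply: le_trans h; rewrite le_eqVlt; apply/orP; left; apply/eqP;
      field; rewrite !gt_eqF.
  have -> : 2 * G * C * (C * eps / E) * (eps * m%:R) =
     G * (2 * (m%:R * (C ^+ 2 * eps ^+ 2)) / E) by field; rewrite gt_eqF.
  rewrite ler_pM2l // ler_pdivlMr //; nra.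
have lnE0 : 0 < ln E by apply: ln_gt0; lra.
have hb0 : b <= 36 * (1 / 100) ^+ 2 * q%:R / expR 2 *
    (Num.min (Lam / L) (Num.sqrt (ln E / L))) ^+ 2.
  apply: le_trans (ler_wpM2l (ltW lam0) hmu) _.
  rewrite le_eqVlt; apply/orP; left; apply/eqP.
  transitivity (144 * (1 / 100) ^+ 2 * q%:R * (G * C) *
     (Num.min (Lam / L) (Num.sqrt (ln E / L))) ^+ 2).
    by rewrite /lam; field; rewrite !gt_eqF.
  by rewrite GC; field; rewrite gt_eqF.
have min0 : 0 <= Num.min (Lam / L) (Num.sqrt (ln E / L)).
  by rewrite le_min sqrtr_ge0 divr_ge0 // ltW.
have hb1 : b <= 1 / 500 * q%:R * (Num.min (Lam / L) (Num.sqrt (ln E / L))) ^+ 2.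
  apply: le_trans hb0 _; apply: ler_wpM2r; first exact: exprn_ge0.
  by rewrite ler_pdivrMr //; nra.
have b0 : 0 <= b by rewrite mulr_ge0 ?exprn_ge0 // ltW.
have hbL : b <= 64^-1 * Lam ^+ 2 / q%:R.
  have h : (Num.min (Lam / L) (Num.sqrt (ln E / L))) ^+ 2 <= 4 * (Lam / q%:R) ^+ 2.
    have -> : 4 * (Lam / q%:R) ^+ 2 = (2 * Lam / q%:R) ^+ 2 by field; rewrite gt_eqF.
    apply: lerXn2r; rewrite ?nnegrE ?divr_ge0 ?mulr_ge0 // ?(ltW Lam0) //.
    rewrite ge_min; apply/orP; left.
    rewrite ler_pdivrMr // mulrAC ler_pdivlMr //; nra.
  apply: (@le_trans _ _ (1 / 500 * q%:R * (4 * (Lam / q%:R) ^+ 2))).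
    by apply: le_trans hb1 _; apply: ler_wpM2l => //; rewrite mulr_ge0 // divr_ge0.
  have -> : 1 / 500 * q%:R * (4 * (Lam / q%:R) ^+ 2) = 4 / 500 * (Lam ^+ 2 / q%:R).
    by field; rewrite gt_eqF.
  have -> : 64^-1 * Lam ^+ 2 / q%:R = 64^-1 * (Lam ^+ 2 / q%:R) by ring.
  by apply: ler_wpM2r; [rewrite divr_ge0 ?sqr_ge0 // ltW | lra].
have hbE : expR (4 * b) <= E.
  have h : (Num.min (Lam / L) (Num.sqrt (ln E / L))) ^+ 2 <= 2 * (ln E / q%:R).
    apply: (@le_trans _ _ (ln E / L)).
      rewrite -[leRHS]sqr_sqrtr ?divr_ge0 // ?(ltW lnE0) ?(ltW L0) //.
      by apply: lerXn2r; rewrite ?nnegrE ?sqrtr_ge0 // ge_min lexx orbT.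
    by rewrite ler_pdivrMr // mulrA mulrAC ler_pdivlMr //; nra.
  have h1 : 4 * b <= ln E.
    apply: (@le_trans _ _ (4 * (1 / 500 * q%:R * (2 * (ln E / q%:R))))).
      rewrite ler_pM2l //; apply: le_trans hb1 _; apply: ler_wpM2l => //.
      by rewrite mulr_ge0 // divr_ge0.
    have -> : 4 * (1 / 500 * q%:R * (2 * (ln E / q%:R))) = 8 / 500 * ln E.
      by field; rewrite gt_eqF.
    lra.
  by rewrite -[leRHS](lnK (x := E)) ?posrE // ler_expR.
have A0 : 0 <= A by rewrite mulr_ge0 // ltW.
have := double_sum_le R b A (2 * G * C) Lam q q0 b0 Lam0 hbL A0 hA.
have -> : 2 * G * C * expR 2 = 1 / 2.
  by rewrite -(mulrA 2) GC; field; rewrite gt_eqF.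
have h2 : 0 <= 2 * G * C by do 2?[apply: mulr_ge0 => //]; exact: ltW.
move=> /(_ h2 (lexx _)) H.
rewrite (eq_big_nat _ _ (F2 := fun l => \sum_(l <= k < q.+1)
   A * (b ^+ (k - l) * A ^+ l.-1 * l%:R ^+ (2 * k) / (k`!%:R * l`!%:R)))); last first.
  move=> l /andP[l2 lq]; apply: eq_big_nat => k /andP[lk kq].
  have -> : lam ^+ k = lam ^+ (k - l) * (lam * lam ^+ l.-1).
    by rewrite -exprS prednK ?(ltnW l2) // -exprD subnK.
  have -> : p ^+ l = p * p ^+ l.-1 by rewrite -exprS prednK ?(ltnW l2).
  rewrite /A /b [(lam * mu ^+ 2) ^+ _]exprMn [(lam * p) ^+ _]exprMn -(exprM mu).
  have f0 n : n`!%:R != 0 :> R by rewrite pnatr_eq0 -lt0n fact_gt0.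
  by field; rewrite !f0.
under eq_bigr => l _ do rewrite -mulr_sumr.
rewrite -mulr_sumr.
apply: le_trans (ler_wpM2l A0 H) _.
(* The factor [E] from [expR (4 * b)] cancels the [1 / E] in [expR (- Lam)]. Since
   [A = G * q / (eps * m)], the bound [eps / G] is what turns into [q / m]. *)
have hfin : A * expR 4 * expR (4 * b) + expR 2 / 2 * expR (- Lam) <= eps / G.
  have e4 : expR 4 = expR 2 ^+ 2 :> R by rewrite -expRM_natl; congr expR; lra.
  have CE : C = (4 * expR 2)^-1 / G by rewrite -GC; field; rewrite gt_eqF.
  apply: (@le_trans _ _ (eps / (8 * G) + eps / (8 * G))).
    apply: lerD.
      apply: (@le_trans _ _ ((2 * G * C * (C * eps / E)) * expR 4 * E)).
        rewrite -eLam; apply: ler_pM => //; rewrite ?expR_ge0 //.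
          by apply: mulr_ge0; rewrite ?expR_ge0.
        by apply: ler_wpM2r; rewrite ?expR_ge0.
      rewrite e4 CE le_eqVlt; apply/orP; left; apply/eqP.
      by field; rewrite !gt_eqF.
    rewrite eLam CE.
    have -> : expR 2 / 2 * ((4 * expR 2)^-1 / G * eps / E) = eps / (8 * G) / E.
      by field; rewrite !gt_eqF.
    rewrite ler_pdivrMr // ler_peMr //; last lra.
    by apply: divr_ge0; [exact: ltW | apply: mulr_ge0 => //; exact: ltW].
  have -> : eps / (8 * G) + eps / (8 * G) = (eps / G) / 4 by field; rewrite gt_eqF.
  have : 0 < eps / G by rewrite divr_gt0.
  lra.
apply: le_trans (ler_wpM2l A0 hfin) _.
rewrite le_eqVlt; apply/orP; left; apply/eqP.
by rewrite /A /lam /p; field; rewrite !gt_eqF.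
Qed.

(** Markov's inequality for the moment of even order [q] of the normalized off diagonal form, at the
    threshold [eps * s / 4]. *)
Lemma hashing_jl (R : realType) (m n s q : nat) (eps E L mu : R) (v : 'cV[R]_n) :
  (0 < m)%N -> (0 < s)%N -> (s <= m)%N -> (0 < q)%N -> ~~ odd q -> 0 < L ->
  L <= q%:R <= 2 * L -> 0 < eps < 1 -> 2 <= E ->
  E * accuracy_const ^- 2 * eps ^- 2 * L <= m%:R ->
  0 <= mu ->
  mu ^+ 2 <= 144 * s%:R * (1 / 100) ^+ 2 * accuracy_const * eps *
    (Num.min (ln (E / (accuracy_const * eps)) / L) (Num.sqrt (ln E / L))) ^+ 2 ->
  (forall j, `|v j 0| <= mu * norm2 v) ->
  #|[set w : hashing_sample m n s |
      ~~ (`|norm2 (hashing_mx R w *m v) ^+ 2 - norm2 v ^+ 2|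
           <= eps / 4 * norm2 v ^+ 2)]|%:R
  <= expR (- (5 * q%:R)) * #|hashing_sample m n s|%:R :> R.
Proof.
move=> m0 s0 sm q0 qev L0 hq heps E2 hm mu0 hmu hv.
set bad := [set w | _].
(* Normalization needs a nonzero norm. Otherwise [hv] forces [v = 0] and no sample is bad. *)
have [N0|Nn0] := eqVneq (norm2 v) 0.
  have v0 : v = 0.
    apply/matrixP => j k; rewrite ord1 mxE; apply/eqP.
    by have := hv j; rewrite N0 mulr0 normr_le0.
  have -> : bad = set0.
    apply/setP => w; rewrite !inE v0 mulmx0 !norm2_sqr.
    rewrite !big1 => [|i _|i _]; rewrite ?mxE ?expr0n //.
    by rewrite subrr normr0 mulr0 lexx.
  by rewrite cards0 mulr_ge0 ?expR_ge0.
have Ngt0 : 0 < norm2 v by rewrite lt_neqAle eq_sym Nn0 sqrtr_ge0.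
have /andP[e0 e1] := heps.
have sR : 0 < s%:R :> R by rewrite ltr0n.
have mR : 0 < m%:R :> R by rewrite ltr0n.
have qR : 0 < q%:R :> R by rewrite ltr0n.
have G0 := rate_const_gt0 R.
pose x j := v j 0 / norm2 v.
have hx j : `|x j| <= mu.
  by rewrite normrM normfV (gtr0_norm Ngt0) ler_pdivrMr // hv.
have x1 : \sum_j x j ^+ 2 = 1.
  under eq_bigr => j _ do rewrite expr_div_n.
  by rewrite -mulr_suml -norm2_sqr divff // expf_neq0.
pose lam : R := rate_const * q%:R / (eps * s%:R).
have lam0 : 0 < lam by apply: divr_gt0; apply: mulr_gt0.
have := @hashing_moment_le R m n s q x mu lam (q%:R / m%:R) m0 sm lam0 mu0 hx x1.
move=> /(_ (@moment_series_le R m s q eps E L mu m0 s0 q0 L0 hq heps E2 hm mu0 hmu)).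
set O := #|hashing_sample m n s|.
case: (posnP O) => [O0|Op].
  have : (#|bad| <= O)%N by exact: max_card.
  by rewrite O0 leqn0 => /eqP -> _; rewrite mulr0.
have OR : 0 < O%:R :> R by rewrite ltr0n.
rewrite ler_pdivrMl // => hmom.
have dev (w : hashing_sample m n s) :
   \sum_i off_diagonal x (fun j => column_entry (w j) i) =
   s%:R * (norm2 (hashing_mx R w *m v) ^+ 2 - norm2 v ^+ 2) / norm2 v ^+ 2.
  rewrite -hashing_norm_dev // mulr_suml; apply: eq_bigr => i _.
  rewrite /off_diagonal mulr_suml; apply: eq_bigr => t _.
  by rewrite /x; field.
have c0 : 0 < eps * s%:R / 4 by rewrite divr_gt0 // mulr_gt0.
have markov : #|bad|%:R * (eps * s%:R / 4) ^+ q <=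
   \sum_(w : hashing_sample m n s)
     (\sum_i off_diagonal x (fun j => column_entry (w j) i)) ^+ q.
  rewrite mulr_natl -sumr_const.
  rewrite [leLHS]big_mkcond /=; apply: ler_sum => w _.
  have evp (z : R) : z ^+ q = `|z| ^+ q.
    by rewrite -normrX ger0_norm // real_exprn_even_ge0 ?num_real.
  rewrite [leRHS]evp; case: ifP => [|_]; last exact: exprn_ge0.
  rewrite inE -ltNge => hw.
  apply: lerXn2r; rewrite ?nnegrE ?(ltW c0) //.
  rewrite dev !normrM (gtr0_norm sR) normfV (gtr0_norm (exprn_gt0 2 Ngt0)).
  rewrite ler_pdivlMr ?exprn_gt0 //.
  have := ler_wpM2l (ltW sR) (ltW hw).
  by have -> : eps * s%:R / 4 * norm2 v ^+ 2 = s%:R * (eps / 4 * norm2 v ^+ 2) by ring.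
have [e6 e5] : expR 6 = expR 5 * expR 1 :> R /\ expR (- (5 * q%:R)) = (expR 5)^-1 ^+ q :> R.
  split; first by rewrite -expRD; congr expR; lra.
  by rewrite -expRN -expRM_natl; congr expR; lra.
(* The left side is at most [(q * e / lam) ^ q], and [q * e / lam = expR (- 5) * eps * s / 4]
   because [rate_const = 4 * expR 6]. *)
have big : q`!%:R / lam ^+ q * (1 + q%:R / m%:R) ^+ m <=
   expR (- (5 * q%:R)) * (eps * s%:R / 4) ^+ q.
  apply: (@le_trans _ _ (q%:R ^+ q / lam ^+ q * expR 1 ^+ q)).
    apply: ler_pM.
    - by rewrite divr_ge0 // exprn_ge0 // ltW.
    - by rewrite exprn_ge0 // addr_ge0 // divr_ge0.
    - apply: ler_wpM2r; first by rewrite invr_ge0 exprn_ge0 // ltW.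
      by rewrite -natrX ler_nat fact_le_expn.
    - by rewrite -expRM_natl mulr1; exact: one_plus_div_expn_le.
  rewrite e5 -exprVn -!exprMn le_eqVlt; apply/orP; left; apply/eqP; congr (_ ^+ _).
  rewrite /lam /rate_const e6; field.
  by rewrite !gt_eqF ?expR_gt0.
rewrite -(ler_pM2r (exprn_gt0 q c0)).
apply: le_trans markov _; apply: le_trans hmom _.
by rewrite [leRHS]mulrAC [leRHS]mulrC; apply: ler_wpM2l.
Qed.

(** * Rademacher tails *)

Lemma rademacher_mgf_le (R : realType) n (a : 'I_n -> R) (th : R) :
  \sum_(b : {ffun 'I_n -> bool}) expR (th * \sum_j (-1) ^+ (b j) * a j)
  <= 2 ^+ n * expR (2 * th ^+ 2 * \sum_j a j ^+ 2).
Proof.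
have -> : \sum_(b : {ffun 'I_n -> bool}) expR (th * \sum_j (-1) ^+ (b j) * a j) =
   \prod_j (expR (- (th * a j)) + expR (th * a j)).
  transitivity (\prod_j \sum_(b : bool) expR (th * ((-1) ^+ b * a j))).
    rewrite bigA_distr_bigA /=; apply: eq_bigr => b _.
    by rewrite mulr_sumr expR_sum.
  apply: eq_bigr => j _; rewrite big_bool /= expr0 expr1 mul1r mulN1r mulrN.
  by [].
rewrite mulr_sumr expR_sum -[2 ^+ n]prodr_ord -big_split /=.
apply: ler_prod => j _; rewrite addr_ge0 ?expR_ge0 //=.
have := cosh_le_expR_sqr R (th * a j).
rewrite ler_pdivrMr // addrC => h; apply: le_trans h _.
by rewrite mulrC exprMn mulrA.
Qed.

(** Chernoff's bound; [th = tau / (4 * V)] minimizes [2 * th ^+ 2 * V - th * tau], with minimum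
    [- tau ^+ 2 / (8 * V)]. *)
Lemma rademacher_tail (R : realType) n (a : 'I_n -> R) (V tau : R) :
  0 < V -> \sum_j a j ^+ 2 <= V -> 0 <= tau ->
  #|[set b : {ffun 'I_n -> bool} | tau < \sum_j (-1) ^+ (b j) * a j]|%:R
  <= expR (- (tau ^+ 2 / (8 * V))) * 2 ^+ n :> R.
Proof.
move=> V0 hV t0; set th := tau / (4 * V).
have th0 : 0 <= th by rewrite divr_ge0 // mulr_ge0 // ltW.
rewrite -(ler_pM2r (expR_gt0 (th * tau))).
apply: (@le_trans _ _ (\sum_(b : {ffun 'I_n -> bool})
    expR (th * \sum_j (-1) ^+ (b j) * a j))).
  rewrite mulr_natl -sumr_const [leLHS]big_mkcond /=; apply: ler_sum => b _.
  by case: ifP => [|_]; rewrite ?expR_ge0 // inE => /ltW h; rewrite ler_expR ler_wpM2l.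
apply: le_trans (rademacher_mgf_le R n a th) _.
rewrite [leRHS]mulrAC [leRHS]mulrC -expRD; apply: ler_wpM2l; first exact: exprn_ge0.
rewrite ler_expR.
apply: (@le_trans _ _ (2 * th ^+ 2 * V)).
  by apply: ler_wpM2l => //; rewrite mulr_ge0 // sqr_ge0.
rewrite le_eqVlt; apply/orP; left; apply/eqP; rewrite /th; field.
by rewrite gt_eqF.
Qed.

(** * Orthonormal bases and the Walsh-Hadamard matrix *)

(** A Gram-Schmidt step: the part [C] of [A] orthogonal to [U] is nonzero, since otherwise [A] would
    have rank at most [k], and one of its nonzero columns is normalized. *)
Lemma orthonormal_extend (R : realType) n d k (A : 'M[R]_(n, d)) (U : 'M[R]_(n, k))
    (Z : 'M[R]_(d, k)) :
  U^T *m U = 1%:M -> U = A *m Z -> (k < \rank A)%N ->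
  exists (U' : 'M[R]_(n, k + 1)) (Z' : 'M[R]_(d, k + 1)),
    U'^T *m U' = 1%:M /\ U' = A *m Z'.
Proof.
move=> UU UE kA.
pose C := A - U *m (U^T *m A).
have C0 : C != 0.
  apply: contraTneq kA => /eqP; rewrite subr_eq0 => /eqP ->.
  by rewrite -leqNgt (leq_trans (mxrankM_maxl _ _)) // rank_leq_col.
have [j cj0] : exists j, col j C != 0.
  apply/existsP; apply: contraNT C0; rewrite negb_exists => /forallP h.
  apply/eqP/matrixP => i j; have /negPn/eqP/matrixP/(_ i 0) := h j.
  by rewrite !mxE.
set c := col j C in cj0.
have UC : U^T *m C = 0 by rewrite mulmxBr (mulmxA U^T U) UU mul1mx subrr.
have Uc : U^T *m c = 0 by rewrite /c colE mulmxA UC mul0mx.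
have CE : C = A *m (1%:M - Z *m (U^T *m A)).
  by rewrite mulmxBr mulmx1 (mulmxA A) -UE.
have cE : c = A *m (col j (1%:M - Z *m (U^T *m A))).
  by rewrite /c CE !colE [RHS]mulmxA.
pose N := \sum_i c i 0 ^+ 2.
have N0 : 0 < N.
  rewrite lt_neqAle sumr_ge0 ?andbT => [|i _]; last exact: sqr_ge0.
  rewrite eq_sym; apply: contra cj0 => /eqP hN; apply/eqP/colP => i.
  rewrite [RHS]mxE; apply/eqP; rewrite -sqrf_eq0.
  move/eqP: hN; rewrite /N psumr_eq0 => [|i' _]; last exact: sqr_ge0.
  by move=> /allP/(_ i); rewrite mem_index_enum => /(_ isT).
have cc : c^T *m c = N%:M.
  apply/matrixP => i l; rewrite !ord1 [RHS]mxE [LHS]mxE eqxx mulr1n.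
  by apply: eq_bigr => i' _; rewrite [c^T _ _]mxE expr2.
exists (row_mx U ((Num.sqrt N)^-1 *: c)).
exists (row_mx Z ((Num.sqrt N)^-1 *: col j (1%:M - Z *m (U^T *m A)))).
split; last by rewrite mul_mx_row -UE -scalemxAr -cE.
rewrite tr_row_mx mul_col_row UU [X in block_mx _ X _ _](_ : _ = 0); last first.
  by rewrite -scalemxAr Uc scaler0.
rewrite [X in block_mx _ _ X _](_ : _ = 0); last first.
  by rewrite linearZ /= -scalemxAl -[c^T *m U]trmxK trmx_mul trmxK Uc trmx0 scaler0.
rewrite [X in block_mx _ _ _ X](_ : _ = 1%:M) ?scalar_mx_block //.
rewrite linearZ /= [(_ *: c)^T]linearZ /= -scalemxAl cc scalerA -invfM -expr2 sqr_sqrtr ?ltW //.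
by rewrite scale_scalar_mx mulVf ?gt_eqF.
Qed.

Lemma orthonormal_basis (R : realType) n d (A : 'M[R]_(n, d)) :
  exists (U : 'M[R]_(n, \rank A)) (W : 'M[R]_(\rank A, d)),
    U^T *m U = 1%:M /\ A = U *m W.
Proof.
have H k : (k <= \rank A)%N -> exists (U : 'M[R]_(n, k)) (Z : 'M[R]_(d, k)),
    U^T *m U = 1%:M /\ U = A *m Z.
  elim: k => [|k IH] hk; first by exists 0, 0; split; rewrite mulmx0 //; apply/matrixP => -[].
  have [U [Z [UU UE]]] := IH (ltnW hk).
  by rewrite -addn1; exact: orthonormal_extend UU UE hk.
have [U [Z [UU UE]]] := H _ (leqnn _).
have rU : \rank U = \rank A.
  apply/eqP; rewrite eqn_leq {1}UE mxrankM_maxl /=.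
  have := mxrankM_maxr U^T U; rewrite UU mxrank1 => h; exact: h.
(* Row spaces are what is compared, hence the transposes. Equality of ranks reverses the inclusion
   and yields the factor [W]. *)
have : (U^T <= A^T)%MS by rewrite {1}UE trmx_mul submxMl.
move/mxrank_leqif_sup => [_]; rewrite !mxrank_tr rU eqxx => /esym/submxP[D hD]; exists U, D^T; split => //.
by apply: trmx_inj; rewrite trmx_mul trmxK.
Qed.

(** * Binary digits and Walsh characters *)

Lemma bit_double (b : bool) (i k : nat) :
  bit (b + i.*2) k = if k is k'.+1 then bit i k' else b.
Proof.
case: k => [|k]; rewrite /bit; first by rewrite expn0 divn1 oddD odd_double addbF; case: b.
by rewrite expnS divnMA divn2 half_bit_double.
Qed.

Lemma sum_expn2 (V : nmodType) (p : nat) (F : nat -> V) :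
  \sum_(i < 2 ^ p.+1) F i = \sum_(i < 2 ^ p) (F i.*2 + F i.*2.+1).
Proof.
have H n : \sum_(i < n.*2) F i = \sum_(i < n) (F i.*2 + F i.*2.+1).
  elim: n => [|n IH]; first by rewrite !big_ord0.
  by rewrite doubleS !big_ord_recr /= IH addrA.
by rewrite expnS mul2n H.
Qed.

(** Pairing [2 i] with [2 i + 1] splits off the lowest digit, which contributes the factor
    [1 + (-1) ^+ c 0]. *)
Lemma walsh_character_sum (R : comNzRingType) (p : nat) (c : nat -> nat) :
  \sum_(i < 2 ^ p) (-1) ^+ (\sum_(k < p) bit i k * c k)%N =
  \prod_(k < p) (1 + (-1) ^+ c k) :> R.
Proof.
elim: p c => [|p IH] c; first by rewrite big_ord1 !big_ord0 expr0.
rewrite (sum_expn2 _ _ (fun i => (-1) ^+ (\sum_(k < p.+1) bit i k * c k)%N)).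
rewrite big_ord_recl /= -(IH (fun k => c k.+1)) mulr_sumr.
apply: eq_bigr => i _; rewrite !big_ord_recl /=.
have E (b : bool) : (\sum_(k < p) bit (b + i.*2) (bump 0 k) * c (bump 0 k) =
    \sum_(k < p) bit i k * c k.+1)%N.
  by apply: eq_bigr => k _; rewrite /bump add1n bit_double.
rewrite -[i.*2.+1]/(true + i.*2)%N -[i.*2 in X in X + _]/(false + i.*2)%N.
by rewrite !E !bit_double mul0n add0n mul1n exprD mulrDl mul1r.
Qed.

Lemma bit_inj (p i j : nat) :
  (i < 2 ^ p)%N -> (j < 2 ^ p)%N -> (forall k, (k < p)%N -> bit i k = bit j k) ->
  i = j.
Proof.
elim: p i j => [|p IH] i j; first by rewrite expn0 !ltnS !leqn0 => /eqP -> /eqP ->.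
rewrite expnS mul2n => hi hj h.
rewrite -(odd_double_half i) -(odd_double_half j).
have := h 0%N isT; rewrite -{1}(odd_double_half i) -{1}(odd_double_half j).
rewrite !bit_double => ->; congr (_ + _.*2)%N.
apply: IH; rewrite ?ltn_half_double // => k kp.
have := h k.+1 kp; rewrite -{1}(odd_double_half i) -{1}(odd_double_half j).
by rewrite !bit_double.
Qed.

Lemma walsh_hadamard_sqr (R : realType) n (i j : 'I_n) :
  walsh_hadamard R n i j ^+ 2 = n%:R^-1.
Proof.
by rewrite mxE exprMn sqrr_sign mulr1 exprVn sqr_sqrtr.
Qed.

(** The inner product of columns [j] and [j'] is a character sum with [c k = bit j k + bit j' k].
    Distinct indices differ in some digit, where [c k = 1] makes a factor vanish. *)
Lemma walsh_hadamard_orthogonal (R : realType) (p : nat) :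
  (walsh_hadamard R (2 ^ p))^T *m walsh_hadamard R (2 ^ p) = 1%:M.
Proof.
apply/matrixP => j j'; rewrite !mxE.
under eq_bigr => i _ do rewrite !mxE up_expnK //.
have n0 : 0 < (2 ^ p)%:R :> R by rewrite ltr0n expn_gt0.
transitivity ((2 ^ p)%:R^-1 * \sum_(i < 2 ^ p)
    (-1) ^+ (\sum_(k < p) bit i k * (bit j k + bit j' k))%N : R).
  rewrite mulr_sumr; apply: eq_bigr => i _.
  rewrite mulrACA -expr2 exprVn sqr_sqrtr ?ltW // -exprD -big_split /=.
  by congr (_ * _ ^+ _); apply: eq_bigr => k _; rewrite mulnDr.
rewrite (walsh_character_sum R p (fun k => bit j k + bit j' k)%N).
have [->|ne] := eqVneq j j'.
  rewrite (eq_bigr (fun=> 2)) => [|k _]; last first.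
    by rewrite -signr_odd oddD addbb expr0.
  by rewrite prodr_const card_ord -natrX mulVf ?gt_eqF.
have [k hk] : exists k : 'I_p, bit j k != bit j' k.
  apply/existsP; apply: contraNT ne; rewrite negb_exists => /forallP h.
  apply/eqP/val_inj/(@bit_inj p) => [||k kp]; rewrite ?ltn_ord //.
  by have /negPn/eqP := h (Ordinal kp).
rewrite (bigD1 k) //= (_ : _ + _ = 0 :> R) ?mul0r ?mulr0 //.
by case: (bit j k) (bit j' k) hk => [] [] //= _; rewrite expr1 subrr.
Qed.

(** * An integer net for quadratic forms *)

(* Integer vectors with coordinates in [- 16 r, 16 r], shifted by [16 r]. *)
Definition net_point (r : nat) : finType :=
  {ffun 'I_r -> 'I_(16 * r + (16 * r).+1)}.

Definition net_vec (R : realType) (r : nat) (z : net_point r) : 'cV[R]_r :=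
  \col_i ((z i)%:R - (16 * r)%:R).

Definition net (R : realType) (r : nat) : {set net_point r} :=
  [set z | \sum_i net_vec R r z i 0 ^+ 2 <= 16 * r%:R].

Lemma sum_half_le (R : realType) (N : nat) :
  \sum_(i < N) (1 / 2 : R) ^+ i.+1 <= 1.
Proof.
have -> : \sum_(i < N) (1 / 2 : R) ^+ i.+1 = 1 - (1 / 2) ^+ N.
  elim: N => [|N IH]; first by rewrite big_ord0 expr0 subrr.
  by rewrite big_ord_recr /= IH !exprS; lra.
have : 0 <= (1 / 2 : R) ^+ N by rewrite exprn_ge0 // divr_ge0.
lra.
Qed.

(** Since [a <= a ^ 2], the sum is bounded by 1 for the centre plus two geometric tails of at most 1
    each. *)
Lemma sum_half_dist_le (R : realType) (B : nat) :
  \sum_(j < B + B.+1) (1 / 2 : R) ^+ (((B - j) + (j - B)) ^ 2) <= 3.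
Proof.
have hle a : (1 / 2 : R) ^+ (a ^ 2) <= (1 / 2) ^+ a.
  apply: ler_wiXn2l; rewrite ?divr_ge0 //; first lra.
  by rewrite expnS expn1; case: a => // a; rewrite leq_pmulr.
apply: (@le_trans _ _ (\sum_(j < B + B.+1) (1 / 2 : R) ^+ ((B - j) + (j - B)))).
  by apply: ler_sum => j _; exact: hle.
rewrite big_split_ord /=.
have -> : \sum_(i < B) (1 / 2 : R) ^+ (B - i + (i - B)) = \sum_(i < B) (1 / 2) ^+ i.+1.
  rewrite (reindex_inj rev_ord_inj) /=; apply: eq_bigr => i _; congr (_ ^+ _).
  by have := ltn_ord i; lia.
have -> : \sum_(i < B.+1) (1 / 2 : R) ^+ (B - (B + i) + (B + i - B)) =
    1 + \sum_(i < B) (1 / 2) ^+ i.+1.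
  rewrite big_ord_recl /= addn0 subnn expr0; congr (_ + _).
  apply: eq_bigr => i _; congr (_ ^+ _); rewrite /bump; lia.
have := sum_half_le R B; lra.
Qed.

Lemma natr_dist_sqr (R : realType) (B j : nat) :
  (j%:R - B%:R) ^+ 2 = (((B - j) + (j - B)) ^ 2)%:R :> R.
Proof.
rewrite natrX; case: (leqP B j) => h.
  by rewrite (eqP h) add0n natrB.
have h' := ltnW h.
by rewrite (eqP h') addn0 (natrB _ h') -sqrrN opprB.
Qed.

(** Each net point has weight [2 ^ (16 r - |z| ^ 2) >= 1], with [|z|] the norm of its vector. Summed
    over the whole grid, this weight factors into [2 ^ (16 r)] and one sum of at most 3 per
    coordinate. *)
Lemma card_net_le (R : realType) (r : nat) :
  #|net R r|%:R <= 2 ^+ (16 * r) * 3 ^+ r :> R.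
Proof.
set B := (16 * r)%N.
pose d (j : nat) := ((B - j) + (j - B))%N.
have dE (j : nat) : (j%:R - B%:R) ^+ 2 = (d j ^ 2)%:R :> R by exact: natr_dist_sqr.
apply: (@le_trans _ _ (\sum_(z : net_point r) 2 ^+ B * \prod_i (1 / 2) ^+ (d (z i) ^ 2))).
  rewrite -sumr_const big_mkcond /=; apply: ler_sum => z _; case: ifP => [|_].
    rewrite inE => h.
    have {}h : (\sum_i d (z i) ^ 2 <= B)%N.
      rewrite -(ler_nat R) natr_sum /B natrM.
      by apply: le_trans h; apply: ler_sum => i _; rewrite -dE mxE.
    rewrite -expr_sum -(subnK h) exprD.
    have -> : (1 / 2 : R) ^+ (\sum_i d (z i) ^ 2) = (2 ^+ (\sum_i d (z i) ^ 2))^-1.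
      by rewrite div1r exprVn.
    rewrite mulfK ?expf_neq0 ?pnatr_eq0 //.
    by rewrite exprn_ege1 // (ler_nat _ 1 2).
  by rewrite mulr_ge0 ?exprn_ge0 // prodr_ge0 // => i _; rewrite exprn_ge0 // divr_ge0.
rewrite -mulr_sumr; apply: ler_wpM2l; first exact: exprn_ge0.
rewrite -(bigA_distr_bigA (fun (i : 'I_r) (j : 'I_(B + B.+1)) => (1 / 2 : R) ^+ (d j ^ 2))) /=.
rewrite prodr_const card_ord; apply: lerXn2r; rewrite ?nnegrE //.
  by apply: sumr_ge0 => j _; rewrite exprn_ge0 // divr_ge0.
exact: sum_half_dist_le.
Qed.

(** An integer is at most its square in absolute value, so the bound on the squared norm already
    places every coordinate in the grid. *)
Lemma net_vec_int (R : realType) (r : nat) (k : 'cV[R]_r) :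
  (forall i, k i 0 \is a Num.int) -> \sum_i k i 0 ^+ 2 <= 16 * r%:R ->
  exists2 z, z \in net R r & net_vec R r z = k.
Proof.
move=> kint hk.
have kb i : `|k i 0| <= (16 * r)%:R.
  have h2 : k i 0 ^+ 2 <= (16 * r)%:R.
    rewrite natrM; apply: le_trans hk; rewrite (bigD1 i) //= lerDl.
    by apply: sumr_ge0 => j _; rewrite sqr_ge0.
  apply: le_trans h2; rewrite -real_normK ?num_real //.
  have /intrP[t ht] := kint i; rewrite ht -intr_norm -natr_absz.
  by rewrite -natrX ler_nat expnS expn1; case: `|t|%N => // a; rewrite leq_pmulr.
have hz i : exists j : 'I_(16 * r + (16 * r).+1), j%:R - (16 * r)%:R = k i 0.
  have /intrP[t ht] := kint i.
  have := kb i; rewrite ht -intr_norm => tb.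
  have {}tb : `|t| <= (16 * r)%N :> int by rewrite -(ler_int R).
  have tj : (`|(t + (16 * r)%N)%R|%N < 16 * r + (16 * r).+1)%N by lia.
  exists (Ordinal tj) => /=.
  have -> : `|(t + (16 * r)%N)%R|%N%:R = t%:~R + (16 * r)%:R :> R.
    rewrite natr_absz ger0_norm; last by lia.
    by rewrite rmorphD.
  by rewrite addrK.
have [f hf] := choice hz.
have E : net_vec R r (finfun f) = k.
  by apply/colP => i; rewrite mxE ffunE hf.
by exists (finfun f); rewrite // inE E.
Qed.

(** * Rounding and polarization of quadratic forms *)

Definition dot {R : realType} {r : nat} (u v : 'cV[R]_r) : R :=
  \sum_i u i 0 * v i 0.

Lemma dotC (R : realType) r (u v : 'cV[R]_r) : dot u v = dot v u.
Proof. by apply: eq_bigr => i _; rewrite mulrC. Qed.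

Lemma dotDr (R : realType) r (u v w : 'cV[R]_r) : dot u (v + w) = dot u v + dot u w.
Proof. by rewrite -big_split /=; apply: eq_bigr => i _; rewrite mxE mulrDr. Qed.

Lemma dotZr (R : realType) r (u v : 'cV[R]_r) a : dot u (a *: v) = a * dot u v.
Proof. by rewrite mulr_sumr; apply: eq_bigr => i _; rewrite mxE mulrCA. Qed.

Lemma dotDl (R : realType) r (u v w : 'cV[R]_r) : dot (v + w) u = dot v u + dot w u.
Proof. by rewrite ![dot _ u]dotC dotDr. Qed.

Lemma dotZl (R : realType) r (u v : 'cV[R]_r) a : dot (a *: v) u = a * dot v u.
Proof. by rewrite ![dot _ u]dotC dotZr. Qed.

Lemma dotNr (R : realType) r (u v : 'cV[R]_r) : dot u (- v) = - dot u v.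
Proof. by rewrite -scaleN1r dotZr mulN1r. Qed.

Lemma dot_ge0 (R : realType) r (u : 'cV[R]_r) : 0 <= dot u u.
Proof. by apply: sumr_ge0 => i _; rewrite -expr2 sqr_ge0. Qed.

Lemma dot_eq0 (R : realType) r (y : 'cV[R]_r) : dot y y = 0 -> y = 0.
Proof.
move=> /eqP y0; apply/colP => i; rewrite mxE; apply/eqP; rewrite -sqrf_eq0 expr2.
move: y0; rewrite psumr_eq0 => [|j _]; last by rewrite -expr2 sqr_ge0.
by move=> /allP/(_ i); rewrite mem_index_enum => /(_ isT).
Qed.

(* Each coordinate is rounded up or down according to the sign of the
   coefficient of the linear functional it is multiplied with. *)
Lemma exists_rounding (R : realType) r (y c : 'cV[R]_r) :
  dot y y <= r%:R ->
  exists k : 'cV[R]_r, [/\ forall i, k i 0 \is a Num.int, dot k k <= 4 * r%:R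
    & dot y c <= dot k c].
Proof.
move=> hy.
pose k : 'cV[R]_r :=
  \col_i (if 0 <= c i 0 then Num.ceil (y i 0) else Num.floor (y i 0))%:~R.
exists k; split.
- by move=> i; rewrite mxE intr_int.
(* If [|a - b| <= 1] then [a ^+ 2 <= 2 * b ^+ 2 + 2]; the two parts sum to at most [2 * r] each. *)
- apply: (@le_trans _ _ (\sum_i (2 * (y i 0 * y i 0) + 2))).
    apply: ler_sum => i _; rewrite mxE.
    have hd : `|(if 0 <= c i 0 then Num.ceil (y i 0) else Num.floor (y i 0))%:~R - y i 0| <= 1.
      case: ifP => _; rewrite ler_norml.
        have := ceil_ge (y i 0); have := ceilB1_lt (y i 0); rewrite rmorphB /=; lra.
      have := floor_le (y i 0); have := floorD1_gt (y i 0); rewrite rmorphD /=; lra.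
    move: hd; set a := _%:~R; move: a (y i 0) => a b hd.
    have h1 : (a - b) ^+ 2 <= 1 by rewrite -real_normK ?num_real // expr_le1.
    have h2 := sqr_ge0 (2 * b - a); lra.
  rewrite big_split /= sumr_const card_ord -mulr_sumr -mulr_natr.
  by move: hy; rewrite /dot; lra.
apply: ler_sum => i _; rewrite mxE; case: ifP => [c0|/negbT].
  by apply: ler_wpM2r => //; exact: ceil_ge.
rewrite -ltNge => /ltW c0; apply: ler_wnM2r => //; exact: floor_le.
Qed.

(** After scaling to squared norm [r], each argument of the form is rounded in turn, so the value is
    at most [dot k' (M *m k)] with [k], [k'] integer vectors of squared norm at most [4 * r].
    Polarization expresses this through [k' + k] and [k' - k], whose squared norms add up to at most
    [16 * r], the radius of the net. *)
Lemma quad_form_net (R : realType) r (M : 'M[R]_r) (eta : R) :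
  0 <= eta -> (forall u v, dot u (M *m v) = dot v (M *m u)) ->
  (forall k : 'cV[R]_r, (forall i, k i 0 \is a Num.int) -> dot k k <= 16 * r%:R ->
     `|dot k (M *m k)| <= eta * dot k k) ->
  forall y, dot y (M *m y) <= 4 * eta * dot y y.
Proof.
move=> eta0 sym H y.
have [y0|yn0] := eqVneq (dot y y) 0.
  by rewrite (dot_eq0 _ _ _ y0) mulmx0 -(scale0r (0 : 'cV[R]_r)) !dotZr !mul0r mulr0.
have ygt0 : 0 < dot y y by rewrite lt_neqAle eq_sym yn0 dot_ge0.
case: (posnP r) => [r0|r0].
  by move: yn0; rewrite /dot big1 ?eqxx // => i; have := ltn_ord i; rewrite [X in (_ < X)%N]r0.
have rR : 0 < r%:R :> R by rewrite ltr0n.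
pose a := Num.sqrt (r%:R / dot y y).
have a2 : a * a * dot y y = r%:R.
  by rewrite -expr2 sqr_sqrtr ?divfK // divr_ge0 // ltW.
have a0 : 0 < a by rewrite sqrtr_gt0 divr_gt0.
pose x := a *: y.
have xx : dot x x = r%:R by rewrite /x dotZr dotC dotZr mulrA.
have xr : dot x x <= r%:R by rewrite xx.
suff : dot x (M *m x) <= 4 * eta * r%:R.
  rewrite /x -scalemxAr dotZr dotC dotZr dotC -a2 => h.
  have : a * a * dot y (M *m y) <= a * a * (4 * eta * dot y y) by lra.
  by rewrite ler_pM2l // mulr_gt0.
have [k [kint kk]] := exists_rounding R r x (M *m x) xr.
move/le_trans; apply; rewrite sym.
have [k' [kint' kk']] := exists_rounding R r x (M *m k) xr.
move/le_trans; apply.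
have bil (N : 'M[R]_r) (t : R) : dot (k' + t *: k) (N *m (k' + t *: k)) =
    dot k' (N *m k') + t * (dot k' (N *m k) + dot k (N *m k')) +
    t ^+ 2 * dot k (N *m k).
  by rewrite mulmxDr -scalemxAr !dotDr !dotZr !dotDl !dotZl; ring.
have pol : 4 * dot k' (M *m k) =
   dot (k' + k) (M *m (k' + k)) - dot (k' - k) (M *m (k' - k)).
  by have := bil M 1; have := bil M (-1); rewrite scaleN1r scale1r (sym k k'); lra.
have nn : dot (k' + k) (k' + k) + dot (k' - k) (k' - k) = 2 * dot k k + 2 * dot k' k'.
  by have := bil 1%:M 1; have := bil 1%:M (-1); rewrite scaleN1r scale1r !mul1mx; lra.
have s0 := dot_ge0 R r (k' + k); have d0 := dot_ge0 R r (k' - k).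
have h1 := H (k' + k); have h2 := H (k' - k).
have {}h1 : `|dot (k' + k) (M *m (k' + k))| <= eta * dot (k' + k) (k' + k).
  by apply: h1 => [i|]; [rewrite mxE rpredD | lra].
have {}h2 : `|dot (k' - k) (M *m (k' - k))| <= eta * dot (k' - k) (k' - k).
  by apply: h2 => [i|]; [rewrite !mxE rpredB | lra].
move: h1 h2; rewrite !ler_norml => /andP[_ h1] /andP[h2 _].
have : eta * (dot (k' + k) (k' + k) + dot (k' - k) (k' - k)) <= eta * (16 * r%:R).
  by apply: ler_wpM2l => //; rewrite nn; lra.
by rewrite mulrDr; lra.
Qed.

Lemma quad_form_norm_net (R : realType) r (M : 'M[R]_r) (eta : R) :
  0 <= eta -> (forall u v, dot u (M *m v) = dot v (M *m u)) ->
  (forall k : 'cV[R]_r, (forall i, k i 0 \is a Num.int) -> dot k k <= 16 * r%:R ->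
     `|dot k (M *m k)| <= eta * dot k k) ->
  forall y, `|dot y (M *m y)| <= 4 * eta * dot y y.
Proof.
move=> eta0 sym H y; rewrite ler_norml; apply/andP; split; last exact: quad_form_net.
have := @quad_form_net R r (- M) eta eta0.
rewrite lerNl => /(_ _ _ y); rewrite mulNmx dotNr; apply.
- by move=> u v; rewrite !mulNmx !dotNr sym.
- by move=> k hk1 hk2; rewrite mulNmx dotNr normrN; exact: H.
Qed.

(** * Assembling the embedding *)

Lemma norm2_dot (R : realType) n (v : 'cV[R]_n) : norm2 v ^+ 2 = dot v v.
Proof. by rewrite norm2_sqr; apply: eq_bigr => i _; rewrite expr2. Qed.

Lemma dot_mulmx (R : realType) n r (P Q : 'M[R]_(n, r)) (u v : 'cV[R]_r) :
  dot u (P^T *m Q *m v) = dot (P *m u) (Q *m v).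
Proof.
have E k (x y : 'cV[R]_k) : dot x y = (x^T *m y) 0 0.
  by rewrite mxE; apply: eq_bigr => i _; rewrite mxE.
by rewrite !E trmx_mul !mulmxA.
Qed.

Lemma dot_orthonormal (R : realType) n r (V : 'M[R]_(n, r)) (u v : 'cV[R]_r) :
  V^T *m V = 1%:M -> dot (V *m u) (V *m v) = dot u v.
Proof. by move=> VV; rewrite -dot_mulmx VV mul1mx. Qed.

Lemma dot_Cauchy_Schwarz (R : realType) r (a b : 'cV[R]_r) :
  dot a b ^+ 2 <= dot a a * dot b b.
Proof.
have := dot_ge0 R r (dot b b *: a - dot a b *: b).
rewrite !dotDl !dotDr -!scaleN1r !dotZl !dotZr (dotC R r b a) => h.
have [b0|bn0] := eqVneq (dot b b) 0; last first.
  have bgt0 : 0 < dot b b by rewrite lt_neqAle eq_sym bn0 dot_ge0.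
  by rewrite -(ler_pM2l bgt0); lra.
have -> : b = 0 by exact: dot_eq0.
by rewrite -(scale0r (0 : 'cV[R]_r)) !dotZr !mul0r mulr0 expr0n.
Qed.

Lemma card_net_le_expR (R : realType) r : #|net R r|%:R <= expR (18 * r%:R) :> R.
Proof.
apply: le_trans (card_net_le R r) _.
have -> : 18 * r%:R = (16 * r)%:R * 1 + r%:R * 2 :> R by rewrite natrM; lra.
rewrite expRD !expRM_natl; apply: ler_pM; rewrite ?exprn_ge0 //.
  by apply: lerXn2r; rewrite ?nnegrE ?expR_ge0 //; have := expR_ge1Dx (1 : R); lra.
by apply: lerXn2r; rewrite ?nnegrE ?expR_ge0 //; have := expR_ge1Dx (2 : R); lra.
Qed.

Lemma card_setC_ge (R : realType) (T : finType) (A : {set T}) (c : R) :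
  #|~: A|%:R <= c * #|T|%:R -> (1 - c) * #|T|%:R <= #|A|%:R.
Proof.
have : #|A|%:R + #|~: A|%:R = #|T|%:R :> R by rewrite -natrD cardsC.
by lra.
Qed.

Lemma card_bigcup_le (R : realType) (I T : finType) (P : pred I) (F : I -> {set T})
    (c : R) :
  (forall i, P i -> #|F i|%:R <= c) ->
  #|\bigcup_(i | P i) F i|%:R <= #|P|%:R * c.
Proof.
move=> h; apply: (@le_trans _ _ (\sum_(i | P i) #|F i|%:R)).
  rewrite -natr_sum ler_nat.
  apply: (big_ind2 (fun (A : {set T}) k => (#|A| <= k)%N)) => //.
    by rewrite cards0.
  move=> A k B l hA hB; apply: leq_trans (leq_add hA hB).
  by rewrite cardsU leq_subr.
by rewrite mulr_natl -sumr_const; apply: ler_sum.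
Qed.

(** A union bound over the net with [hashing_jl]. Outside the bad events the form of [M], which is
    the distortion, has accuracy [eps / 4] at integer points, hence [eps] everywhere. *)
Lemma hashing_embedding (R : realType) (m n s q r : nat) (eps delta E mu : R)
    (V : 'M[R]_(n, r)) :
  let L := 4 * r%:R + ln (1 / delta) in
  (0 < m)%N -> (0 < s)%N -> (s <= m)%N -> (0 < q)%N -> ~~ odd q ->
  0 < delta < 1 -> 0 < L -> L <= q%:R <= 2 * L -> 0 < eps < 1 -> 2 <= E ->
  E * accuracy_const ^- 2 * eps ^- 2 * L <= m%:R ->
  0 <= mu ->
  mu ^+ 2 <= 144 * s%:R * (1 / 100) ^+ 2 * accuracy_const * eps *
    (Num.min (ln (E / (accuracy_const * eps)) / L) (Num.sqrt (ln E / L))) ^+ 2 ->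
  V^T *m V = 1%:M -> (forall j, \sum_l V j l ^+ 2 <= mu ^+ 2) ->
  (1 - delta) * #|hashing_sample m n s|%:R <=
  #|[set w : hashing_sample m n s | `[< forall y : 'cV[R]_r,
      `|norm2 (hashing_mx R w *m (V *m y)) ^+ 2 - norm2 (V *m y) ^+ 2|
        <= eps * norm2 (V *m y) ^+ 2 >]]|%:R.
Proof.
move=> L m0 s0 sm q0 qev /andP[d0 d1] L0 hq heps E2 hm mu0 hmu VV hV.
have /andP[e0 e1] := heps.
pose bad (z : net_point r) := [set w : hashing_sample m n s |
      ~~ (`|norm2 (hashing_mx R w *m (V *m net_vec R r z)) ^+ 2 -
            norm2 (V *m net_vec R r z) ^+ 2|
           <= eps / 4 * norm2 (V *m net_vec R r z) ^+ 2)].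
(* Cauchy-Schwarz turns the bound on the rows of [V] into a bound on every entry of a vector in its
   range. *)
have coh (y : 'cV[R]_r) j : `|(V *m y) j 0| <= mu * norm2 (V *m y).
  have -> : norm2 (V *m y) = norm2 y.
    by apply/eqP; rewrite -(@eqrXn2 _ 2) ?sqrtr_ge0 // !norm2_dot dot_orthonormal.
  rewrite -(@ler_pXn2r _ 2) ?nnegrE ?mulr_ge0 ?sqrtr_ge0 //.
  rewrite real_normK ?num_real // exprMn norm2_dot.
  have -> : (V *m y) j 0 = dot (row j V)^T y.
    by rewrite mxE; apply: eq_bigr => l _; rewrite !mxE.
  apply: le_trans (dot_Cauchy_Schwarz R r _ _) _.
  apply: ler_wpM2r; first exact: dot_ge0.
  by apply: le_trans (hV j); apply: ler_sum => l _; rewrite !mxE expr2.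
have hbad z : #|bad z|%:R <= expR (- (5 * q%:R)) * #|hashing_sample m n s|%:R :> R.
  by apply: (@hashing_jl R m n s q eps E L mu) => // j; exact: coh.
apply: card_setC_ge.
set O := #|hashing_sample m n s| in hbad *.
apply: (@le_trans _ _ (#|\bigcup_(z in net R r) bad z|%:R)); last first.
  apply: le_trans (card_bigcup_le R _ _ (mem (net R r)) bad _ (fun z _ => hbad z)) _.
  rewrite mulrA; apply: ler_wpM2r => //.
  apply: le_trans (ler_wpM2r (expR_ge0 _) (card_net_le_expR R r)) _.
  (* [5 * q] is at least [20 * r + 5 * ln (1 / delta)], which exceeds [18 * r + ln (1 / delta)]. *)
  rewrite -expRD -[leRHS]lnK ?posrE // ler_expR.
  have hl : ln (1 / delta) = - ln delta by rewrite div1r lnV ?posrE.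
  have : ln delta < 0 by rewrite ln_lt0 // d0.
  have : 0 <= r%:R :> R by [].
  by case/andP: hq; rewrite /L hl; lra.
rewrite ler_nat; apply/subset_leq_card/subsetP => w.
rewrite inE; apply: contraR => hw; rewrite inE; apply/asboolP => y.
pose S := hashing_mx R w *m V.
pose M := S^T *m S - V^T *m V.
have dM u v : dot u (M *m v) = dot (S *m u) (S *m v) - dot (V *m u) (V *m v).
  by rewrite mulmxBl dotDr dotNr !dot_mulmx.
have hM (x : 'cV[R]_r) : norm2 (hashing_mx R w *m (V *m x)) ^+ 2 - norm2 (V *m x) ^+ 2 =
    dot x (M *m x).
  by rewrite dM !norm2_dot mulmxA.
rewrite hM norm2_dot dot_orthonormal //.
have -> : eps = 4 * (eps / 4) by field.
apply: quad_form_norm_net.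
- by rewrite divr_ge0 // ltW.
- by move=> u v; rewrite !dM ![dot (_ *m u) _]dotC.
move=> k kint kk.
have kk' : \sum_i k i 0 ^+ 2 <= 16 * r%:R.
  by apply: le_trans kk; apply: ler_sum => i _; rewrite expr2.
have [z zn zk] := net_vec_int R r k kint kk'.
have : w \notin bad z by apply: contra hw => wz; apply/bigcupP; exists z.
by rewrite inE negbK zk hM norm2_dot dot_orthonormal.
Qed.

(** * Row norms after the randomized Hadamard transform *)

Lemma sign_diag_orthogonal (R : realType) n (b : {ffun 'I_n -> bool}) :
  (sign_diag_mx R b)^T *m sign_diag_mx R b = 1%:M.
Proof.
rewrite /sign_diag_mx tr_diag_mx mulmx_diag -diag_const_mx; congr diag_mx.
by apply/rowP => j; rewrite !mxE -expr2 sqrr_sign.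
Qed.

Lemma randomized_hadamard_orthonormal (R : realType) (p r : nat)
    (b : {ffun 'I_(2 ^ p) -> bool}) (U : 'M[R]_(2 ^ p, r)) :
  U^T *m U = 1%:M ->
  (walsh_hadamard R (2 ^ p) *m sign_diag_mx R b *m U)^T *m
   (walsh_hadamard R (2 ^ p) *m sign_diag_mx R b *m U) = 1%:M.
Proof.
move=> UU; rewrite !trmx_mul -!mulmxA.
rewrite (mulmxA (walsh_hadamard R (2 ^ p))^T) walsh_hadamard_orthogonal mul1mx.
by rewrite (mulmxA (sign_diag_mx R b)^T) sign_diag_orthogonal mul1mx.
Qed.

(** Against a net vector [k], a row of [H D U] is a Rademacher sum with variance at most
    [16 * r / n]. A row longer than [mu], rescaled and rounded, yields a net vector against which
    this sum exceeds [sqrt r * mu]. The union bound runs over the rows and the net; the tail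
    exponent is [mu ^+ 2 * n / 128]. *)
Lemma randomized_hadamard_rows (R : realType) (p r : nat) (delta1 mu : R)
    (U : 'M[R]_(2 ^ p, r)) :
  (0 < r)%N -> 0 < delta1 < 1 -> 0 <= mu -> U^T *m U = 1%:M ->
  128 * (18 * r%:R + ln ((2 ^ p)%:R / delta1)) <= mu ^+ 2 * (2 ^ p)%:R ->
  (1 - delta1) * #|{: {ffun 'I_(2 ^ p) -> bool}}|%:R <=
  #|[set b : {ffun 'I_(2 ^ p) -> bool} |
      [forall i, \sum_l (walsh_hadamard R (2 ^ p) *m sign_diag_mx R b *m U) i l ^+ 2
         <= mu ^+ 2]]|%:R.
Proof.
move=> r0 /andP[d0 d1] mu0 UU hmu.
set n := (2 ^ p)%N in U UU hmu *.
have rR : 0 < r%:R :> R by rewrite ltr0n.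
have nR : 0 < n%:R :> R by rewrite ltr0n expn_gt0.
pose H := walsh_hadamard R n.
pose a (i : 'I_n) (z : net_point r) (j : 'I_n) : R := H i j * (U *m net_vec R r z) j 0.
pose tau := Num.sqrt r%:R * mu.
pose bad (i : 'I_n) (z : net_point r) :=
  [set b : {ffun 'I_n -> bool} | tau < \sum_j (-1) ^+ (b j) * a i z j].
pose V := 16 * r%:R / n%:R : R.
have V0 : 0 < V by rewrite divr_gt0 // mulr_gt0.
have tau0 : 0 <= tau by rewrite mulr_ge0 // sqrtr_ge0.
have hbad i z : z \in net R r ->
    #|bad i z|%:R <= expR (- (tau ^+ 2 / (8 * V))) * 2 ^+ n :> R.
  move=> zn; apply: rademacher_tail => //.
  apply: (@le_trans _ _ (n%:R^-1 * dot (U *m net_vec R r z) (U *m net_vec R r z))).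
    rewrite mulr_sumr; apply: ler_sum => j _.
    by rewrite /a exprMn walsh_hadamard_sqr expr2.
  rewrite dot_orthonormal // mulrC; apply: ler_wpM2r; first by rewrite invr_ge0.
  by move: zn; rewrite inE -norm2_sqr norm2_dot.
rewrite card_ffun card_bool card_ord natrX.
have -> : (2 ^+ n : R) = #|{: {ffun 'I_n -> bool}}|%:R.
  by rewrite card_ffun card_bool card_ord natrX.
apply: card_setC_ge.
apply: (@le_trans _ _ (#|\bigcup_(t | t.2 \in net R r) bad t.1 t.2|%:R)); last first.
  apply: le_trans (card_bigcup_le R _ _ (fun t : 'I_n * net_point r => t.2 \in net R r)
     (fun t => bad t.1 t.2) _ (fun t ht => hbad t.1 t.2 ht)) _.
  have -> : #|(fun t : 'I_n * net_point r => t.2 \in net R r)| = (n * #|net R r|)%N.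
    rewrite -[n in RHS]card_ord -cardX; apply: eq_card => -[i z].
    by rewrite !inE.
  rewrite card_ffun card_bool card_ord natrX mulrA; apply: ler_wpM2r; first exact: exprn_ge0.
  have hE : expR (- (tau ^+ 2 / (8 * V))) <=
      expR (- (18 * r%:R + ln (n%:R / delta1))).
    rewrite ler_expR lerN2.
    have -> : tau ^+ 2 / (8 * V) = mu ^+ 2 * n%:R / 128.
      rewrite exprMn sqr_sqrtr ?ltW // /V; field.
      by rewrite !gt_eqF.
    by rewrite ler_pdivlMr // mulrC.
  rewrite natrM.
  apply: (@le_trans _ _ (n%:R * expR (18 * r%:R) *
     expR (- (18 * r%:R + ln (n%:R / delta1))))).
    apply: ler_pM; [by rewrite mulr_ge0 | exact: expR_ge0 | | exact: hE].
    by apply: ler_wpM2l; [exact: ltW | exact: card_net_le_expR].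
  rewrite -mulrA -expRD.
  have -> : 18 * r%:R - (18 * r%:R + ln (n%:R / delta1)) = - ln (n%:R / delta1) by ring.
  rewrite expRN lnK ?posrE ?divr_gt0 // invf_div.
  by rewrite mulrC divfK // gt_eqF.
rewrite ler_nat; apply/subset_leq_card/subsetP => b.
rewrite !inE negb_forall => /existsP[i]; rewrite -ltNge => hi.
set W := walsh_hadamard R n *m sign_diag_mx R b *m U in hi.
pose g : 'cV[R]_r := (row i W)^T.
have gg : dot g g = \sum_l W i l ^+ 2.
  by apply: eq_bigr => l _; rewrite !mxE expr2.
have ggt0 : 0 < dot g g by rewrite gg (le_lt_trans _ hi) // sqr_ge0.
(* Scaling the row to squared norm [r] makes [exists_rounding] applicable, and the pairing of
   [c *: g] with [g] is [sqrt r] times the norm of [g]. *)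
pose c := Num.sqrt (r%:R / dot g g).
have c0 : 0 <= c by exact: sqrtr_ge0.
have c2 : c ^+ 2 = r%:R / dot g g by rewrite sqr_sqrtr // divr_ge0 // ltW.
have yy : dot (c *: g) (c *: g) <= r%:R.
  by rewrite dotZl dotZr mulrA -expr2 c2 divfK // gt_eqF.
have [k [kint kk hk]] := exists_rounding R r (c *: g) g yy.
have kk' : \sum_i k i 0 ^+ 2 <= 16 * r%:R.
  rewrite -norm2_sqr norm2_dot; lra.
have [z zn zk] := net_vec_int R r k kint kk'.
apply/bigcupP; exists (i, z) => //=; rewrite inE.
have -> : \sum_j (-1) ^+ (b j) * a i z j = dot k g.
  rewrite dotC.
  have -> : dot g k = (W *m k) i 0.
    by rewrite mxE; apply: eq_bigr => l _; rewrite !mxE.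
  rewrite /W -!mulmxA mxE; apply: eq_bigr => j _.
  rewrite /a zk mulrCA; congr (_ * _).
  by rewrite mul_diag_mx mxE [X in _ = X * _]mxE.
apply: lt_le_trans hk; rewrite dotZl.
rewrite -(@ltr_pXn2r _ 2) ?nnegrE ?mulr_ge0 ?(ltW ggt0) ?sqrtr_ge0 //.
rewrite !exprMn c2 sqr_sqrtr ?(ltW rR) //.
have -> : r%:R / dot g g * dot g g ^+ 2 = r%:R * dot g g by field; rewrite gt_eqF.
by rewrite ltr_pM2l // gg.
Qed.

(** The witness is twice the ceiling of [L / 2], which lies below [L + 2]. *)
Lemma exists_even_between (R : realType) (L : R) :
  4 <= L -> exists q : nat, [/\ (0 < q)%N, ~~ odd q & L <= q%:R <= 2 * L].
Proof.
move=> L4; have h1 := ceil_ge (L / 2); have h2 := ceilB1_lt (L / 2).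
have c0 : 0 <= Num.ceil (L / 2) by rewrite ceil_ge0; lra.
move: c0 h1 h2; case: (Num.ceil (L / 2)) => // t _; rewrite rmorphB /= => h1 h2.
exists t.*2; split.
- by rewrite double_gt0 lt0n; apply/eqP => t0; move: h1; rewrite t0; lra.
- by rewrite odd_double.
- by rewrite -muln2 natrM; apply/andP; split; move: h1 h2; rewrite -!pmulrn; lra.
Qed.

Lemma card_hashing_sample_gt0 m n s : (s <= m)%N -> (0 < #|hashing_sample m n s|)%N.
Proof.
move=> sm; have inj : injectiveb [ffun k : 'I_s => widen_ord sm k].
  by apply/injectiveP => k k'; rewrite !ffunE => /(congr1 val) /= /val_inj.
pose f : rows_sample m s := exist (fun f : {ffun 'I_s -> 'I_m} => injectiveb f) _ inj.
by apply/card_gt0P; exists [ffun => (f, [ffun => false])].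
Qed.

Lemma hrht_subspace_embedding (R : realType) m n s d r (eps : R)
    (w : hrht_sample m n s) (U : 'M[R]_(n, r)) (W : 'M[R]_(r, d)) :
  let V := walsh_hadamard R n *m sign_diag_mx R w.2 *m U in
  U^T *m U = 1%:M -> V^T *m V = 1%:M ->
  (forall y : 'cV[R]_r,
      `|norm2 (hashing_mx R w.1 *m (V *m y)) ^+ 2 - norm2 (V *m y) ^+ 2|
        <= eps * norm2 (V *m y) ^+ 2) ->
  subspace_embedding eps (hrht_mx R w) (U *m W).
Proof.
move=> V UU VV H _ [z ->].
have := H (W *m z).
have -> : hrht_mx R w *m (U *m W *m z) = hashing_mx R w.1 *m (V *m (W *m z)).
  by rewrite /hrht_mx /V !mulmxA.
have -> : norm2 (V *m (W *m z)) ^+ 2 = norm2 (U *m W *m z) ^+ 2.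
  by rewrite -(mulmxA U) !norm2_dot (dot_orthonormal _ _ _ V) ?(dot_orthonormal _ _ _ U).
by rewrite ler_norml => /andP[h1 h2]; split; lra.
Qed.

(** Conditioning on the second component: the pairs are counted fibre by fibre, and only the fibres
    over [B] are kept. *)
Lemma uniform_prob_pair_ge (R : realType) (T1 T2 : finType) (E : T1 * T2 -> Prop)
    (B : {set T2}) (c1 c2 : R) :
  0 <= c1 -> (0 < #|T1|)%N -> (0 < #|T2|)%N ->
  c2 * #|T2|%:R <= #|B|%:R ->
  (forall b, b \in B -> c1 * #|T1|%:R <= #|[set a | `[< E (a, b) >]]|%:R) ->
  c1 * c2 <= uniform_prob R E.
Proof.
move=> c10 T1p T2p hB hE.
have T1R : 0 < #|T1|%:R :> R by rewrite ltr0n.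
have T2R : 0 < #|T2|%:R :> R by rewrite ltr0n.
rewrite /uniform_prob card_prod natrM ler_pdivlMr ?mulr_gt0 //.
apply: (@le_trans _ _ (\sum_(b in B) #|[set a | `[< E (a, b) >]]|%:R)).
  apply: (@le_trans _ _ (\sum_(b in B) c1 * #|T1|%:R)); last exact: ler_sum.
  rewrite sumr_const -(mulr_natl (c1 * _)).
  have -> : c1 * c2 * (#|T1|%:R * #|T2|%:R) = (c2 * #|T2|%:R) * (c1 * #|T1|%:R) by ring.
  by apply: ler_wpM2r => //; rewrite mulr_ge0.
rewrite -natr_sum ler_nat.
have -> : #|[set w | `[< E w >]]| = (\sum_(b : T2) #|[set a | `[< E (a, b) >]]|)%N.
  transitivity (\sum_(a : T1) \sum_(b : T2) (`[< E (a, b) >] : nat))%N.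
    rewrite -sum1_card big_mkcond pair_bigA /=; apply: eq_bigr => -[a b] _.
    by rewrite inE; case: ifP.
  rewrite exchange_big /=; apply: eq_bigr => b _.
  rewrite -sum1_card [RHS]big_mkcond; apply: eq_bigr => a _.
  by rewrite inE; case: ifP.
by rewrite [X in (_ <= X)%N](bigID (mem B)) /= leq_addr.
Qed.

Lemma add_le_sqr_sqrtD (R : realType) (a b : R) :
  0 <= a -> 0 <= b -> a + b <= (Num.sqrt a + Num.sqrt b) ^+ 2.
Proof.
move=> a0 b0; rewrite sqrrD !sqr_sqrtr //.
have : 0 <= Num.sqrt a * Num.sqrt b by rewrite mulr_ge0 ?sqrtr_ge0.
lra.
Qed.

Lemma mu_bar_gt0 (R : realType) (C1 C2 : R) r (E eps delta : R) :
  0 < C1 -> 0 < C2 -> C2 < 1 -> 0 < eps < 1 -> 2 <= E ->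
  0 < 4 * r%:R + ln (1 / delta) -> 0 < mu_bar C1 C2 r E eps delta.
Proof.
move=> C10 C20 C21 /andP[e0 e1] E2 L0.
have Ce0 : 0 < C2 * eps by exact: mulr_gt0.
have a1 : 0 < ln (E / (C2 * eps)) by apply: ln_gt0; rewrite ltr_pdivlMr //; nra.
have a2 : 0 < ln E by apply: ln_gt0; lra.
apply: mulr_gt0; first by rewrite !mulr_gt0 // sqrtr_gt0.
by rewrite lt_min sqrtr_gt0; apply/andP; split; apply: divr_gt0.
Qed.

Theorem theorem6 (R : realType) :
  exists C1 C2 C3 CM Cnu Cs : R,
    [/\ 0 < C1, 0 < C2 & 0 < C3] /\ [/\ 0 < CM, 0 < Cnu & 0 < Cs] /\
    forall (r d n m s : nat) (eps delta E delta1 : R),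
      (0 < r)%N -> (r <= d)%N -> (d <= n)%N ->
      (exists p : nat, n = (2 ^ p)%N) ->
      (0 < m)%N -> (m <= n)%N ->
      0 < eps < 1 -> eps < C3 ->
      0 < delta < C3 ->
      (1 <= s)%N ->
      s%:R <= Cs * C2^-1 * eps^-1 * (4 * r%:R + ln (1 / delta)) ->
      0 < E ->
      CM <= E ->
      E <= C2 ^+ 2 * eps ^+ 2 * s%:R * (4 * r%:R + ln (1 / delta))^-1
           * expR (Cs * (C2 * eps * s%:R)^-1 * (4 * r%:R + ln (1 / delta))) ->
      m%:R >= Num.max (E * C2 ^- 2 * eps ^- 2 * (4 * r%:R + ln (1 / delta)))
                      (s%:R * expR 1) ->
      0 < delta1 < 1 ->
      n%:R >= (Num.sqrt r%:R + Num.sqrt (8 * ln (n%:R / delta1))) ^+ 2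
              / (s%:R * Cnu ^+ 2 * C1 ^- 2
                 * mu_bar C1 C2 r E eps delta ^+ 2) ->
      forall A : 'M[R]_(n, d), \rank A = r ->
        uniform_prob R
          (fun w : hrht_sample m n s => subspace_embedding eps (hrht_mx R w) A)
        >= (1 - delta) * (1 - delta1).
Proof.
(* [CM = 2] supplies [2 <= E]. The small [Cnu] makes [X] so small that the coherence bound [mu] can
   be taken with [mu ^+ 2 = 14400 * X]. *)
exists 1, accuracy_const, 1, 2, (1 / 1000), 1; split; first by split; rewrite ?accuracy_const_gt0.
split; first by split=> //; lra.
move=> r d n m s eps delta E delta1 r0 rd dn [p np] m0 mn heps _ hdelta s1 _ _ E2 _.
move=> hm hd1 hn A rA.
have /andP[e0 e1] := heps; have /andP[d0 d1] := hdelta.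
have /andP[dd0 dd1] := hd1.
move: hm; rewrite ge_max => /andP[hm hsm].
set L := 4 * r%:R + ln (1 / delta) in hm hn *.
have rR : 1 <= r%:R :> R by rewrite (ler_nat _ 1).
have sR : 0 < s%:R :> R by rewrite ltr0n.
have lnd : 0 < ln (1 / delta) by rewrite ln_gt0 // ltr_pdivlMr // mul1r.
have L4 : 4 <= L by rewrite /L; lra.
have L0 : 0 < L by lra.
have sm : (s <= m)%N.
  rewrite -(ler_nat R); apply: le_trans hsm.
  by rewrite ler_peMr //; have := expR_ge1Dx (1 : R); lra.
have [q [q0 qev hq]] := exists_even_between R L L4.
have C20 := accuracy_const_gt0 R; have C21 := accuracy_const_lt1 R.
have mb0 : 0 < mu_bar 1 accuracy_const r E eps delta by exact: mu_bar_gt0.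
pose X : R := s%:R * (1 / 1000) ^+ 2 * 1 ^- 2 * mu_bar 1 accuracy_const r E eps delta ^+ 2.
have X0 : 0 < X.
  rewrite /X expr1n invr1 mulr1.
  have h1 : 0 < (1 / 1000 : R) ^+ 2 by rewrite exprn_gt0 // divr_gt0.
  have h2 := exprn_gt0 2 mb0.
  by apply: mulr_gt0 => //; exact: mulr_gt0.
(* The factor 100 turns [(1 / 1000) ^+ 2] into [(1 / 100) ^+ 2], so that [mu2] equals the coherence
   bound required by [hashing_embedding]. *)
pose mu2 : R := 144 * (100 * X).
have mu20 : 0 < mu2 by apply: mulr_gt0 => //; exact: mulr_gt0.
pose mu := Num.sqrt mu2.
have mumu : mu ^+ 2 = mu2 by rewrite sqr_sqrtr // ltW.
have hmu : mu ^+ 2 <= 144 * s%:R * (1 / 100) ^+ 2 * accuracy_const * eps *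
    (Num.min (ln (E / (accuracy_const * eps)) / L) (Num.sqrt (ln E / L))) ^+ 2.
  rewrite mumu /mu2 /X /mu_bar -/L mul1r !exprMn !sqr_sqrtr ?(ltW C20) ?(ltW e0) //.
  by rewrite le_eqVlt; apply/orP; left; apply/eqP; field.
subst n.
have nR : 1 <= (2 ^ p)%:R :> R by rewrite (ler_nat _ 1) expn_gt0.
have lnn : 0 <= ln ((2 ^ p)%:R / delta1).
  by apply: ln_ge0; rewrite ler_pdivlMr // mul1r (le_trans (ltW dd1)).
have hmun : 128 * (18 * r%:R + ln ((2 ^ p)%:R / delta1)) <= mu ^+ 2 * (2 ^ p)%:R.
  (* Without the cross term, [hn] gives [r + 8 * l <= N * X] with [l = ln (N / delta1)]; multiplied
     by 14400 this dominates [128 * (18 * r + l)]. *)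
  rewrite -/X ler_pdivrMr // in hn.
  have hX := le_trans (add_le_sqr_sqrtD R _ _ (ler0n R r) (mulr_ge0 (ler0n R 8) lnn)) hn.
  rewrite mumu /mu2; move: (ln _) lnn hX => l l0.
  move: (X) => x; move: ((2 ^ p)%:R) => N; clear -l0 rR; lra.
have [U [W [UU AE]]] := orthonormal_basis R _ _ A.
rewrite rA in U W UU AE *.
apply: uniform_prob_pair_ge; first by rewrite subr_ge0 ltW.
- exact: card_hashing_sample_gt0.
- by rewrite card_ffun card_bool card_ord expn_gt0.
- exact: (randomized_hadamard_rows R p r delta1 mu U r0 hd1 (sqrtr_ge0 _) UU hmun).
move=> b; rewrite inE => /forallP hb.
pose V := walsh_hadamard R (2 ^ p) *m sign_diag_mx R b *m U.
have VV : V^T *m V = 1%:M by exact: randomized_hadamard_orthonormal.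
apply: le_trans (hashing_embedding R m (2 ^ p) s q r eps delta E mu V m0 s1 sm q0 qev
  hdelta L0 hq heps E2 hm (sqrtr_ge0 _) hmu VV hb) _.
rewrite ler_nat; apply/subset_leq_card/subsetP => w; rewrite !inE => /asboolP hw.
by apply/asboolP; rewrite AE; exact: (hrht_subspace_embedding R m _ s d r eps (w, b) U W UU VV hw).
Qed.
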